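(* Let $R$ be a Noetherian integral domain. Then $R^\sigma$ is $(S_2)$.
   Context: For an integral domain $R$, $R^\nu$ denotes its normalization (integral closure in its fraction field), $R^{n\sigma}=\bigcap_{\mathfrak{p}}R_{\mathfrak{p}}$ where $\mathfrak{p}$ runs over all primes of $R$ of height $1$ (the intersection is taken in the fraction field), and $R^\sigma=R^{n\sigma}\cap R^\nu$. For a Noetherian domain $R$ and an $R$-subalgebra $S$ of $R^\nu$ (possibly not Noetherian), $S$ is called $(S_2)$ if for all nonzero $a\in S$, $aS$ is a finite intersection of primary ideals of height $1$; for $S$ Noetherian this is Serre's condition $(S_2)$. *)

(* Defs.v *)
From HB Require Import structures.
From mathcomp Require Import all_boot all_order all_algebra ring_quotient.
From mathcomp Require Import boolp classical_sets.

Set Implicit Arguments.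
Unset Strict Implicit.
Unset Printing Implicit Defensive.

Import GRing.Theory.
Local Open Scope classical_set_scope.
Local Open Scope ring_scope.

Section Ideals.
Variable A : comNzRingType.
Implicit Types I P Q : set A.

Definition ideal I : Prop := GRing.submod_closed (mem I : {pred A^o}).

Definition noetherian : Prop :=
  forall I, ideal I -> exists (n : nat) (g : 'I_n -> A),
    I = [set x | exists c : 'I_n -> A, x = \sum_i c i * g i].

(* [idealr_closed] includes [1 \notin _]: primes and primary ideals are
   proper. *)
Definition prime_ideal P : Prop :=
  idealr_closed (mem P) /\ prime_idealr_closed (mem P).

Definition primary_ideal Q : Prop :=
  idealr_closed (mem Q) /\
  forall u v, Q (u * v) -> Q u \/ exists n, Q (v ^+ n).

(* There is a chain of primes c 0 < c 1 < ... < c n = P of length n. *)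
Definition prime_height_ge P (n : nat) : Prop :=
  exists c : nat -> set A,
    [/\ forall i, (i <= n)%N -> prime_ideal (c i),
        forall i, (i < n)%N -> c i `<` c i.+1 & c n = P].

Definition prime_height P (n : nat) : Prop :=
  prime_height_ge P n /\ ~ prime_height_ge P n.+1.

(* The height of an ideal is the least height of the primes containing it. *)
Definition ideal_height I (n : nat) : Prop :=
  (forall P, prime_ideal P -> I `<=` P -> prime_height_ge P n) /\
  exists P, [/\ prime_ideal P, I `<=` P & prime_height P n].

(* Condition (S_2) for a ring that need not be Noetherian. The empty
   intersection is the whole ring, which is the case where a is a unit. *)
Definition S2 : Prop :=
  forall a : A, a != 0 -> exists (n : nat) (Q : 'I_n -> set A),
    (forall i, primary_ideal (Q i) /\ ideal_height (Q i) 1) /\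
    [set a * b | b in [set: A]] = \bigcap_(i in [set: 'I_n]) Q i.

End Ideals.

Section Sigma.
Variable R : idomainType.
Local Notation K := {fraction R}.
Local Notation "x %:F" := (@tofrac R x).

Definition localization (p : set R) : set K :=
  [set x | exists r s, ~ p s /\ x = r%:F / s%:F].

Definition normalization : set K := [set x | integralOver (@tofrac R) x].

Definition nsigma : set K :=
  \bigcap_(p in [set p : set R | prime_ideal p /\ prime_height p 1])
    localization p.

Definition sigma : set K := nsigma `&` normalization.

Definition sigma_pred : {pred K} := mem sigma.

Lemma prime_neq0 (p : set R) s : prime_ideal p -> ~ p s -> s%:F != 0.
Proof.
move=> [[p0 _ _] _] ps; rewrite tofrac_eq0; apply/eqP => s0.
by apply: ps; rewrite s0; move: p0; rewrite inE.
Qed.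

Lemma prime_notM (p : set R) s t :
  prime_ideal p -> ~ p s -> ~ p t -> ~ p (s * t).
Proof.
move=> [_ pM] ps pt pst.
by have /orP[] := pM s t (mem_set pst); rewrite inE.
Qed.

Lemma tofrac_sigma r : sigma r%:F.
Proof.
split; last exact: integral_id.
move=> p [[[_ p1 _] _] _]; exists r, 1; split; last by rewrite tofrac1 divr1.
by move=> /mem_set p1'; rewrite p1' in p1.
Qed.

Lemma sigmaB x y : sigma x -> sigma y -> sigma (x - y).
Proof.
move=> [xn xi] [yn yi]; split; last exact: integral_sub.
move=> p hp; have [pp _] := hp.
have [r [s [ps ex]]] := xn p hp; have [r' [s' [ps' ey]]] := yn p hp.
exists (r * s' + (- r') * s), (s * s'); split; first exact: prime_notM.
rewrite ex ey -mulNr -tofracN tofracD 3!tofracM.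
by apply: addf_div; exact: prime_neq0 pp _.
Qed.

Lemma sigmaM x y : sigma x -> sigma y -> sigma (x * y).
Proof.
move=> [xn xi] [yn yi]; split; last exact: integral_mul.
move=> p hp; have [pp _] := hp.
have [r [s [ps ex]]] := xn p hp; have [r' [s' [ps' ey]]] := yn p hp.
exists (r * r'), (s * s'); split; first exact: prime_notM.
rewrite ex ey 2!tofracM; exact: mulf_div.
Qed.

Lemma sigma_subring_closed : subring_closed sigma_pred.
Proof.
split=> [|x y /set_mem xs /set_mem ys|x y /set_mem xs /set_mem ys].
- by apply: mem_set; rewrite -tofrac1; exact: tofrac_sigma.
- by apply: mem_set; exact: sigmaB.
- by apply: mem_set; exact: sigmaM.
Qed.

HB.instance Definition _ :=
  GRing.isSubringClosed.Build K sigma_pred sigma_subring_closed.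

Record sigma_ring : Type :=
  SigmaRing { sigma_val : K; _ : sigma_val \in sigma_pred }.

HB.instance Definition _ := [isSub for sigma_val].
HB.instance Definition _ := [Choice of sigma_ring by <:].
HB.instance Definition _ := [SubChoice_isSubComNzRing of sigma_ring by <:].

End Sigma.

(* Main.v *)
Require Import Defs.
From mathcomp Require Import all_boot all_algebra.
From mathcomp Require Import ring_quotient generic_quotient ring.
From mathcomp Require Import boolp classical_sets cardinality.

(* Write S for R^sigma. Since S is integral over R, it suffices to attach to each
   nonzero a in R finitely many subrings V of the fraction field, each a
   localization of S at a prime of height one, such that y lies in S as soon as
   ay lies in S and y in every V: then aS is the intersection of the aV cap S,
   which are primary of height one.

   Some of the V are the R_p, for the height-one primes p of R containing a. The
   others are discrete valuation rings. For a prime q of R let T(q) be the set of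
   the t integral over R_q with r^n t in R_q for all r in q and n >> 0; the V
   needed are the localizations of T(q) at height-one primes above q, for q a
   prime of height at least 2 associated to aR. They are finitely many because,
   as in the Krull-Akizuki theorem, T(q)/dT(q) is a Noetherian R_q-module for
   every nonzero d in R_q.

   To separate y from S one may assume that (S :_R y) is a prime q. If it has
   height one, R_q does not contain y. Otherwise y is not integral over R_q, and
   q y lies in a ring B with cB in R_q for some nonzero c. Let W be the analogue
   of T(q) for B, and let z be a multiple of y for which P = (W : z) is prime.
   As z is not integral and W is Noetherian modulo its nonzero elements, no
   nonzero x has all z^i x in W; so W_P is a discrete valuation ring with
   uniformizer 1/z not containing y, and it is also a localization of T(q). *)

Set Implicit Arguments.
Unset Strict Implicit.
Unset Printing Implicit Defensive.

Import GRing.Theory.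
Local Open Scope classical_set_scope.
Local Open Scope ring_scope.

(** * Subrings and submodules of a field, Noetherian induction, finite sets of primes *)

Section Subsets.
Variable F : fieldType.
Implicit Types (A B I L M N P T V W : set F) (x y z : F).

Definition subring A :=
  [/\ A 1, forall x y, A x -> A y -> A (x - y)
    & forall x y, A x -> A y -> A (x * y)].

Definition submod A M :=
  [/\ M 0, forall x y, M x -> M y -> M (x - y)
    & forall r x, A r -> M x -> M (r * x)].

Definition scale x M : set F := [set x * y | y in M].

Definition prime_in A P :=
  [/\ submod A P, P `<=` A, ~ P 1
    & forall x y, A x -> A y -> P (x * y) -> P x \/ P y].

(* For M = A this is the local ring of A at P, inside F. *)
Definition loc A P M : set F :=
  [set x | exists s, [/\ A s, ~ P s & M (s * x)]].

(* M / L is a Noetherian A-module, without forming the quotient. *)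
Definition noeth A L M := forall Phi : set (set F),
  Phi !=set0 -> (forall N, Phi N -> [/\ submod A N, L `<=` N & N `<=` M]) ->
  exists2 N, Phi N & forall N', Phi N' -> N `<=` N' -> N' `<=` N.

(* As 0^-1 = 0, the condition ~ V v^-1 says that v is nonzero and not a unit. *)
Definition dim1 V := subring V /\
  forall v w, V v -> V w -> ~ V v^-1 -> exists n, V (v ^+ n / w).

Lemma subring1 A : subring A -> A 1. Proof. by case. Qed.
Lemma subringB A x y : subring A -> A x -> A y -> A (x - y).
Proof. by case=> _ h _; exact: h. Qed.
Lemma subringM A x y : subring A -> A x -> A y -> A (x * y).
Proof. by case=> _ _; exact. Qed.
Lemma subring0 A : subring A -> A 0.
Proof. by move=> h; rewrite -(subrr 1); apply: subringB => //; exact: subring1. Qed.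
Lemma subringN A x : subring A -> A x -> A (- x).
Proof. by move=> h Ax; rewrite -sub0r; apply: subringB => //; exact: subring0. Qed.
Lemma subringD A x y : subring A -> A x -> A y -> A (x + y).
Proof. by move=> h Ax Ay; rewrite -(opprK y); apply: subringB => //; exact: subringN. Qed.
Lemma subringX A x n : subring A -> A x -> A (x ^+ n).
Proof.
move=> h Ax; elim: n => [|n IH]; first by rewrite expr0; exact: subring1.
by rewrite exprS; exact: subringM.
Qed.

Lemma submod0 A M : submod A M -> M 0. Proof. by case. Qed.
Lemma submodB A M x y : submod A M -> M x -> M y -> M (x - y).
Proof. by case=> _ h _; exact: h. Qed.
Lemma submodM A M r x : submod A M -> A r -> M x -> M (r * x).
Proof. by case=> _ _; exact. Qed.
Lemma submodN A M x : submod A M -> M x -> M (- x).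
Proof. by move=> h Mx; rewrite -sub0r; apply: (submodB h) => //; exact: submod0 h. Qed.
Lemma submodD A M x y : submod A M -> M x -> M y -> M (x + y).
Proof. by move=> h Mx My; rewrite -(opprK y); apply: (submodB h) => //; exact: submodN h _. Qed.
Lemma submod_sub A B M : A `<=` B -> submod B M -> submod A M.
Proof. by move=> AB [M0 MB MM]; split=> // r x /AB; exact: MM. Qed.
Lemma subring_submod A B : A `<=` B -> subring B -> submod A B.
Proof.
move=> AB h; split; [exact: subring0 | by move=> *; exact: subringB|].
by move=> r x /AB; exact: subringM.
Qed.

Lemma submod_scale A M x : submod A M -> submod A (scale x M).
Proof.
move=> h; split.
- by exists 0; rewrite ?mulr0 //; exact: submod0 h.
- by move=> _ _ [u Mu <-] [v Mv <-]; exists (u - v); [exact: submodB h _ _ | ring].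
- by move=> r _ Ar [u Mu <-]; exists (r * u); [exact: submodM h _ _ | ring].
Qed.

Lemma submod_adjoin A M x : subring A -> submod A M ->
  submod A [set m + r * x | m in M & r in A].
Proof.
move=> hA h; split.
- exists 0; first exact: submod0 h.
  by exists 0; [exact: subring0 | ring].
- move=> _ _ [m Mm [r Ar <-]] [m' Mm' [r' Ar' <-]].
  exists (m - m'); first exact: submodB h _ _.
  by exists (r - r'); [exact: subringB | ring].
- move=> s _ As [m Mm [r Ar <-]].
  exists (s * m); first exact: submodM h _ _.
  by exists (s * r); [exact: subringM | ring].
Qed.

Lemma adjoin_sub A M x : subring A -> M `<=` [set m + r * x | m in M & r in A].
Proof. by move=> hA m Mm; exists m => //; exists 0; [exact: subring0 | ring]. Qed.

Lemma adjoin_mem A M x : subring A -> submod A M ->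
  [set m + r * x | m in M & r in A] x.
Proof.
by move=> hA h; exists 0; [exact: submod0 h | exists 1; [exact: subring1 | ring]].
Qed.

Lemma submod_colon A M x : subring A -> submod A M ->
  submod A [set r | A r /\ M (r * x)].
Proof.
move=> hA h; split.
- by split; [exact: subring0 | rewrite mul0r; exact: submod0 h].
- move=> r s [Ar Mr] [As Ms]; split; first exact: subringB.
  by rewrite mulrBl; exact: submodB h _ _.
- move=> r s Ar [As Ms]; split; first exact: subringM.
  by rewrite -mulrA; exact: submodM h _ _.
Qed.

(** Noetherian induction from the top down: a maximal [N] without [G] would contradict [step]. *)
Lemma noeth_ind A L M (G : set F -> Prop) : noeth A L M ->
  (forall N, submod A N -> L `<=` N -> N `<=` M ->
     (forall N', submod A N' -> N `<=` N' -> N' `<=` M -> ~ N' `<=` N -> G N') ->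
     G N) ->
  forall N, submod A N -> L `<=` N -> N `<=` M -> G N.
Proof.
move=> hn step N0 sN0 LN0 N0M; apply: contrapT => nG.
have [||N [[sN LN NM] nGN] maxN] := hn
  [set N | [/\ submod A N, L `<=` N & N `<=` M] /\ ~ G N].
- by exists N0.
- by move=> N [].
apply: nGN; apply: step => // N' sN' NN' N'M nN'N; apply: contrapT => nGN'.
apply: nN'N; apply: maxN => //; split=> //; split=> //.
exact: subset_trans NN'.
Qed.

Lemma noeth_chain A L M (N : nat -> set F) : noeth A L M ->
  (forall n, [/\ submod A (N n), L `<=` N n & N n `<=` M]) ->
  (forall n, N n `<=` N n.+1) -> exists n, N n.+1 `<=` N n.
Proof.
move=> hn hN inc; have [|_ [n _ <-] //|_ [n _ <-] maxn] := hn (range N).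
  by exists (N 0); exists 0.
by exists n; apply: maxn; [exists n.+1 | exact: inc].
Qed.

Lemma noeth_mono A L M L' M' : L `<=` L' -> M' `<=` M ->
  noeth A L M -> noeth A L' M'.
Proof.
move=> LL MM hn Phi ne h; apply: hn => // N /h [sN LN NM]; split=> //.
  exact: subset_trans LL LN.
exact: subset_trans NM MM.
Qed.

Lemma noeth_scale A L M x : x != 0 ->
  noeth A (scale x L) (scale x M) -> noeth A L M.
Proof.
move=> x0 hn Phi [N0 PN0] h.
have [|_ [N /h [sN LN NM] <-]|_ [N PN <-] maxN] := hn [set scale x N | N in Phi].
- by exists (scale x N0); exists N0.
- split; first exact: submod_scale.
  + by move=> _ [u Lu <-]; exists u => //; exact: LN.
  + by move=> _ [u Nu <-]; exists u => //; exact: NM.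
exists N => // N' PN' NN' u N'u.
have sNN' : scale x N `<=` scale x N' by move=> _ [v Nv <-]; exists v => //; exact: NN'.
have [||v Nv /(mulfI x0) <- //] := maxN (scale x N') _ sNN' (x * u).
- by exists N'.
- by exists u.
Qed.

(** As for minimal primes: if [u * v] is in [I] but neither factor is, every prime over [I] contains
    one of the larger ideals I + uT and I + vT. *)
Lemma finite_primes_over A T L : subring A -> subring T -> A `<=` T ->
  noeth A L T -> submod T L -> L `<=` T ->
  exists2 X : set (set F), finite_set X &
    forall P, prime_in T P -> L `<=` P ->
      exists2 P0, X P0 & [/\ prime_in T P0, L `<=` P0 & P0 `<=` P].
Proof.
move=> hA hT AT hn sL LT.
(* The Noetherian hypothesis is over [A], so the induction runs over [A]-submodules and carries
   [submod T I] as a premise. *)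
suff: forall I, submod A I -> L `<=` I -> I `<=` T -> submod T I ->
  exists2 X : set (set F), finite_set X &
    forall P, prime_in T P -> I `<=` P ->
      exists2 P0, X P0 & [/\ prime_in T P0, I `<=` P0 & P0 `<=` P].
  by apply=> //; exact: submod_sub AT sL.
apply: (noeth_ind hn) => I _ LI IT IH sTI.
have [I1|nI1] := pselect (I 1).
  by exists set0 => // P [_ _ nP1 _] IP; case: nP1; exact: IP.
have [pI|] := pselect (forall x y, T x -> T y -> I (x * y) -> I x \/ I y).
  exists [set I]; first exact: finite_set1.
  by move=> P _ IP; exists I => //; split.
move=> /existsNP[u /existsNP[v /not_implyP[Tu /not_implyP[Tv /not_implyP[Iuv]]]]].
move=> /not_orP[nIu nIv].
have adj w : T w -> ~ I w -> exists2 X : set (set F), finite_set X &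
    forall P, prime_in T P -> I `<=` P -> P w ->
      exists2 P0, X P0 & [/\ prime_in T P0, I `<=` P0 & P0 `<=` P].
  move=> Tw nIw; pose J := [set m + r * w | m in I & r in T].
  have sJ : submod T J by exact: submod_adjoin.
  have IJ : I `<=` J by exact: adjoin_sub.
  have [|||||X fX hX] := IH J => //.
  - exact: submod_sub AT sJ.
  - by move=> _ [m Im [r Tr <-]]; apply: subringD => //; [exact: IT | exact: subringM].
  - by move=> JI; apply: nIw; apply: JI; exact: adjoin_mem.
  exists X => // P pP IP Pw; have [sP _ _ _] := pP.
  have [|P0 XP0 [pP0 JP0 P0P]] := hX P pP.
    by move=> _ [m Im [r Tr <-]]; apply: (submodD sP); [exact: IP | exact: submodM sP _ _].
  by exists P0 => //; split=> //; exact: subset_trans JP0.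
have [X fX hX] := adj u Tu nIu; have [Y fY hY] := adj v Tv nIv.
exists (X `|` Y); first by rewrite finite_setU.
move=> P pP IP; have [_ _ _ pr] := pP; have [Pu|Pv] := pr u v Tu Tv (IP _ Iuv).
  by have [P0] := hX P pP IP Pu; exists P0 => //; left.
by have [P0] := hY P pP IP Pv; exists P0 => //; right.
Qed.

(* The annihilator of the class of x in (A / L)_q is q A_q. *)
Definition weak_assoc A L q x :=
  forall r, A r -> q r <-> exists s, [/\ A s, ~ q s & L (r * s * x)].

Lemma weak_assocM A L q x s : subring A -> submod A L -> prime_in A q -> A s -> ~ q s ->
  weak_assoc A L q x -> weak_assoc A L q (s * x).
Proof.
move=> hA sL [sq _ _ pq] As nqs h r Ar; split.
  move=> /(h r Ar)[t [At nqt Lt]]; exists t; split=> //.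
  by rewrite mulrCA; exact: submodM sL _ _.
move=> [t [At nqt Lt]]; apply/(h r Ar); exists (t * s); split.
- exact: subringM.
- by move=> /(pq t s At As)[].
- by rewrite !mulrA in Lt *.
Qed.

(** Take [I] maximal among the submodules with finitely many associated primes. If [I] were proper,
    adjoining an [x] whose colon ideal [p] = (I : x) is largest would add only the prime [p]. *)
Lemma finite_weak_assoc A L : subring A -> noeth A L A -> submod A L ->
  L `<=` A -> exists2 X : set (set F), finite_set X &
    forall q x, prime_in A q -> A x -> weak_assoc A L q x -> X q.
Proof.
move=> hA hn sL LA.
pose G I := submod A I /\ exists2 X : set (set F), finite_set X &
  forall q x, prime_in A q -> I x -> weak_assoc A L q x -> X q.
have [||I [LI IA [sI [X fX hX]]] maxI] := hn
  [set I | [/\ L `<=` I, I `<=` A & G I]].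
- exists L; split=> //; split=> //; exists set0 => // q x [_ _ nq1 _] Lx h.
  apply: (nq1); apply/(h 1 (subring1 hA)); exists 1; rewrite !mul1r; split=> //.
  + exact: subring1.

- by move=> N [? ? []].
have [AI|/existsNP[y /not_implyP[Ay nIy]]] := pselect (A `<=` I).
  by exists X => // q x pq Ax; apply: hX => //; exact: AI.
pose C x := [set r | A r /\ I (r * x)].
have [||p [x [Ax nIx Ep]] maxp] := hn
    [set p | exists x, [/\ A x, ~ I x & p = C x]].
- by exists (C y), y.
- move=> _ [x [Ax nIx ->]]; split; first exact: submod_colon.
  + move=> u Lu; split; first exact: LA.
    by rewrite mulrC; apply: (submodM sI) => //; exact: LI.
  + by move=> u [].
(* A largest colon ideal is prime: (I : ux) contains [p], so it equals [p] unless [u * x] lies in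
   [I]. *)
have pp u v : A u -> A v -> p (u * v) -> p u \/ p v.
  move=> Au Av; rewrite Ep => -[_ Iuv]; have [Iu|nIu] := pselect (I (u * x)).
    by left.
  right; have : C (u * x) `<=` p.
    apply: maxp; first by exists (u * x); split=> //; exact: subringM.
    move=> w; rewrite Ep => -[Aw Iw]; split=> //.
    by rewrite mulrCA; exact: submodM sI _ _.
  by rewrite Ep; apply; split=> //; rewrite mulrCA mulrA.
exfalso; apply: nIx.
apply: (maxI [set m + r * x | m in I & r in A]); last first.
- exact: adjoin_mem.
- exact: adjoin_sub.
split.
- by move=> u Lu; apply: adjoin_sub => //; exact: LI.
- by move=> _ [m Im [r Ar <-]]; apply: subringD => //; [exact: IA | exact: subringM].
split; first exact: submod_adjoin.
exists (X `|` [set p]); first by rewrite finite_setU.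
move=> q _ pq [i Ii [c Ac <-]] wq.
have [sq qA nq1 qM] := pq.
have [Ic|nIc] := pselect (I (c * x)).
  by left; apply: hX wq => //; exact: submodD sI _ _.
(* If some [s] in [p] lies outside [q], multiplication by [s] moves the element into [I] and keeps
   [q] weakly associated. Otherwise [p] lies in [q], and the two turn out to be equal. *)
have [pleq|/existsNP[s /not_implyP[]]] := pselect (p `<=` q); last first.
  rewrite Ep => -[As Is] nqs; left; apply: (hX q (s * (i + c * x))) => //.
    rewrite mulrDr; apply: (submodD sI); first exact: submodM sI _ _.
    by rewrite mulrCA; exact: submodM sI _ _.
  exact: weak_assocM.
right; apply/seteqP; split=> // r qr; have Ar := qA _ qr.
have [t [At nqt Lt]] := (wq r Ar).1 qr.
have npc : ~ p c by rewrite Ep => -[].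
have npt : ~ p t by move/pleq.
have : p (r * t * c).
  rewrite Ep; split; first by do !apply: subringM.
  suff -> : r * t * c * x = r * t * (i + c * x) - r * t * i by
    apply: (submodB sI); [exact: LI | apply: (submodM sI) => //; exact: subringM].
  by ring.
by move=> /(pp _ _ (subringM hA Ar At) Ac)[/(pp _ _ Ar At)[]|].
Qed.

End Subsets.

(** * Torsion at the maximal ideal of a local ring, and the Krull-Akizuki argument *)

Section Torsion.
Variable F : fieldType.
Implicit Types (A B I L M N P T V W m : set F) (x y z : F).

(** For a finitely generated ideal [m] of [B] this is the ideal transform, the union of the (B :
    m^n); letting [n] depend on [r] avoids choosing generators. *)
Definition tors m B : set F :=
  [set w | forall r, m r -> exists n, B (r ^+ n * w)].

Lemma sub_tors m B : B `<=` tors m B.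
Proof. by move=> x Bx r _; exists 0; rewrite expr0 mul1r. Qed.

Lemma tors_subring m B : subring B -> m `<=` B -> subring (tors m B).
Proof.
move=> hB mB; split; first by apply: sub_tors; exact: subring1.
- move=> x y hx hy r mr; have [n Bn] := hx r mr; have [k Bk] := hy r mr.
  exists (n + k)%N.
  have -> : r ^+ (n + k) * (x - y) = r ^+ k * (r ^+ n * x) - r ^+ n * (r ^+ k * y).
    by rewrite exprD; ring.
  by apply: subringB => //; apply: subringM => //; apply: subringX => //; exact: mB.
- move=> x y hx hy r mr; have [n Bn] := hx r mr; have [k Bk] := hy r mr.
  exists (n + k)%N.
  have -> : r ^+ (n + k) * (x * y) = (r ^+ n * x) * (r ^+ k * y).
    by rewrite exprD; ring.
  exact: subringM.
Qed.

Variables A m : set F.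
Hypotheses (hA : subring A) (hm : prime_in A m).
Hypothesis mV : forall x, A x -> ~ m x -> A x^-1.
Hypothesis nA : noeth A [set 0] A.

Let smm : submod A m. Proof. by case: hm. Qed.
Let mA : m `<=` A. Proof. by case: hm. Qed.

(** An [x] in [N] outside [I] with (I : x) maximal works: were rx outside [I], then (I : rx) = (I :
    x), and the exponent in r^n x could be lowered within [I] down to [x] itself. *)
Lemma socle I N : submod A I -> submod A N ->
  (forall x r, N x -> m r -> exists n, I (r ^+ n * x)) -> ~ N `<=` I ->
  exists x, [/\ N x, ~ I x & forall r, m r -> I (r * x)].
Proof.
move=> sI sN tN /existsNP[x0 /not_implyP[Nx0 nIx0]].
pose C x := [set r | A r /\ I (r * x)].
have [||_ [x [Nx nIx <-]] maxx] := nA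
  (Phi := [set J | exists x, [/\ N x, ~ I x & C x = J]]).
- by exists (C x0), x0.
- move=> _ [x [Nx nIx <-]]; split; first exact: submod_colon.
  + move=> _ ->; split; first exact: subring0.
    by rewrite mul0r; exact: submod0 sI.
  + by move=> r [].
exists x; split=> // r mr; apply: contrapT => nIrx.
have Ar := mA mr.
have maxr : C (r * x) `<=` C x.
  apply: maxx.
    by exists (r * x); split=> //; exact: submodM sN _ _.
  move=> s [As Is]; split=> //; rewrite mulrCA; exact: submodM sI _ _.
have [n] := tN x r Nx mr; elim: n => [|n IH]; first by rewrite expr0 mul1r.
move=> h; apply: IH; have [] : C x (r ^+ n) by
  apply: maxr; split; [exact: subringX | rewrite mulrA -exprSr].
by [].
Qed.

(** N/L is Noetherian and [m]-torsion, hence of finite length, so descending chains in it stabilize.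
    The proof enlarges a submodule [I] on which the chain is stable by one simple factor. *)
Lemma tors_dcc L N (D : nat -> set F) : submod A L -> submod A N ->
  L `<=` N -> N `<=` A ->
  (forall x r, N x -> m r -> exists n, L (r ^+ n * x)) ->
  (forall k, [/\ submod A (D k), L `<=` D k & D k.+1 `<=` D k]) ->
  exists n0, forall k x, (n0 <= k)%N -> N x -> D n0 x -> D k x.
Proof.
move=> sL sN LN NA tN hD.
have Dle j k x : (j <= k)%N -> D k x -> D j x.
  move=> /subnK <-; elim: (k - j)%N => // n IH.
  by rewrite addSn => h; apply: IH; have [_ _] := hD (n + j)%N; apply.
have [||I [sI LI IN [n0 hn0]] maxI] := nA (Phi := [set I | [/\ submod A I,
    L `<=` I, I `<=` N & exists n0, forall k x, (n0 <= k)%N -> I x -> D n0 x -> D k x]]).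
- exists L; split=> //; exists 0 => k x _ Lx _; have [_ h _] := hD k; exact: h.
- move=> I [sI LI IN _]; split=> //; last exact: subset_trans NA.
  by move=> _ ->; exact: submod0 sI.
have [NI|nNI] := pselect (N `<=` I).
  by exists n0 => k x le Nx; apply: hn0 => //; exact: NI.
have tNI x r : N x -> m r -> exists n, I (r ^+ n * x).
  by move=> Nx mr; have [n Ln] := tN x r Nx mr; exists n; exact: LI.
have [x [Nx nIx mx]] := socle sI sN tNI nNI.
exfalso; apply: nIx; pose J := [set i + r * x | i in I & r in A].
apply: (maxI J); last by exact: adjoin_mem.
  2: exact: adjoin_sub.
have sJ : submod A J by exact: submod_adjoin.
have IJ : I `<=` J by exact: adjoin_sub.
split=> //; first exact: subset_trans IJ.
  by move=> _ [i Ii [r Ar <-]]; apply: (submodD sN); [exact: IN | exact: submodM sN _ _].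
(* As J/I is simple, the part of [D k] in [J] either falls into [I] for some [k], or always has an
   element i' + c' x with [c'] a unit, which serves to reduce elements of [D n0] into [I]. *)
have [[k hk]|/forallNP hD'] := pselect (exists k, forall y, J y -> D k y -> I y).
  exists (maxn k n0) => j y; rewrite geq_max => /andP[kj n0j] Jy Dy.
  have Dk := Dle _ _ _ (leq_maxl k n0) Dy.
  apply: hn0 => //; first exact: hk.
  exact: Dle _ _ _ (leq_maxr k n0) Dy.
exists n0 => k y n0k [i Ii [c Ac <-]] Dy.
have /existsNP[_ /not_implyP[[i' Ii' [c' Ac' <-]] /not_implyP[Dy' nIy']]] := hD' k.
have nmc' : ~ m c'.
  by move=> mc'; apply: nIy'; apply: (submodD sI) => //; exact: mx.
have c'0 : c' != 0 by apply/eqP => c'0; apply: nmc'; rewrite c'0; exact: submod0 smm.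
have [sDk _ _] := hD k; have [sD0 _ _] := hD n0.
have Au : A (c / c') by apply: subringM => //; exact: mV.
have Iw : I (i - c / c' * i') by apply: (submodB sI) => //; exact: submodM sI _ _.
have E : i + c * x = (i - c / c' * i') + c / c' * (i' + c' * x) by field.
rewrite E; apply: (submodD sDk); last exact: submodM sDk _ _.
apply: hn0 => //.
have -> : i - c / c' * i' = (i + c * x) - c / c' * (i' + c' * x) by field.
by apply: (submodB sD0) => //; apply: (submodM sD0) => //; exact: Dle n0k _.
Qed.

(* Matijevic's generalization of the Krull-Akizuki theorem. *)
Lemma noeth_tors M d : submod A M -> M `<=` tors m A -> A d -> d != 0 ->
  noeth A (scale d M) M.
Proof.
move=> sM tM Ad d0; have [md|nmd] := pselect (m d); last first.
  have Ms : M `<=` scale d M.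
    move=> x Mx; exists (d^-1 * x); last by rewrite mulrA divff ?mul1r.
    by apply: (submodM sM) => //; exact: mV.
  move=> Phi [N PN] h; exists N => // N' /h[_ _ N'M] _ x /N'M /Ms.
  by have [_ LN _] := h N PN; exact: LN.
pose L := scale d A.
(* N/L is the [m]-torsion of A/dA. *)
pose N := [set x | A x /\ forall r, m r -> exists n, L (r ^+ n * x)].
have sA : submod A A by exact: subring_submod.
have sL : submod A L by exact: submod_scale.
have LA : L `<=` A by move=> _ [x Ax <-]; exact: subringM.
have sN : submod A N.
  split.
  - by split; [exact: subring0 | move=> r _; exists 0; rewrite mulr0; exact: submod0 sL].
  - move=> x y [Ax hx] [Ay hy]; split; first exact: subringB.
    move=> r mr; have [n Ln] := hx r mr; have [k Lk] := hy r mr.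
    exists (n + k)%N.
    have -> : r ^+ (n + k) * (x - y) = r ^+ k * (r ^+ n * x) - r ^+ n * (r ^+ k * y).
      by rewrite exprD; ring.
    by apply: (submodB sL); apply: (submodM sL) => //; apply: subringX => //; exact: mA.
  - move=> s x As [Ax hx]; split; first exact: subringM.
    move=> r /hx [n Ln]; exists n.
    by rewrite mulrCA; exact: submodM sL _ _.
(* The preimage of the image in A/dA of the intersection of [A] with d^(k+1) M; it decreases with
   [k] and stabilizes on [N]. *)
pose D k := [set y + x | x in L & y in [set y | A y /\ scale (d ^+ k.+1) M y]].
have sD k : submod A (D k).
  split.
  - exists 0; first exact: submod0 sL.
    exists 0; last by rewrite addr0.
    split; first exact: subring0.
    by exists 0; [exact: submod0 sM | rewrite mulr0].
  - move=> _ _ [x Lx [y [Ay sy] <-]] [x' Lx' [y' [Ay' sy'] <-]].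
    exists (x - x'); first exact: submodB sL _ _.
    exists (y - y'); last by ring.
    by split; [exact: subringB | exact: submodB (submod_scale _ sM) _ _].
  - move=> r _ Ar [x Lx [y [Ay sy] <-]].
    exists (r * x); first exact: submodM sL _ _.
    exists (r * y); last by ring.
    by split; [exact: subringM | exact: submodM (submod_scale _ sM) _ _].
have [n0 hn0] : exists n0, forall k x, (n0 <= k)%N -> N x -> D n0 x -> D k x.
  apply: (tors_dcc sL sN) => //.
  - move=> x Lx; split; first exact: LA.
    by move=> r _; exists 0; rewrite expr0 mul1r.
  - by move=> x [].
  - by move=> x r [_]; exact.
  - move=> k; split=> //.
    + move=> x Lx; exists x => //; exists 0; last by rewrite add0r.
      split; first exact: subring0.
      by exists 0; [exact: submod0 sM | rewrite mulr0].
    + move=> _ [x Lx [y [Ay [t Mt Et]] <-]]; exists x => //.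
      rewrite -Et in Ay *.
      exists (d ^+ k.+2 * t) => //; split=> //; exists (d * t).
        exact: submodM sM _ _.
      by rewrite mulrA -exprSr.
(* Stability lowers denominators: changing [t] by elements of dM, one factor [d] at a time, makes
   d^(n0+1) enough to bring it into [A]. *)
have key k t : M t -> A (d ^+ (n0.+1 + k) * t) ->
    exists2 t', M t' & A (d ^+ n0.+1 * (t - d * t')).
  elim: k t => [|k IH] t Mt At.
    by exists 0; [exact: submod0 sM | rewrite mulr0 subr0 -[n0.+1]addn0].
  have Dt j : (j <= n0.+1 + k)%N -> D j (d ^+ (n0.+1 + k.+1) * t).
    move=> le; exists 0; first exact: submod0 sL.
    exists (d ^+ (n0.+1 + k.+1) * t); last by rewrite addr0.
    split=> //; exists (d ^+ (n0.+1 + k - j) * t).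
      by apply: (submodM sM) => //; exact: subringX.
    by rewrite mulrA -exprD addnS addSn subnKC.
  have Nt : N (d ^+ (n0.+1 + k.+1) * t).
    split=> // r mr; have [n An] := tM _ (submodM sM (subringX (n0.+1 + k) hA Ad) Mt) r mr.
    exists n; exists (r ^+ n * (d ^+ (n0.+1 + k) * t)) => //.
    by rewrite addnS exprS; ring.
  have [_ [s As <-] [y [Ay [t' Mt' Ey]] E]] :=
    hn0 (n0.+1 + k.+1)%N _ (leq_trans (leqnSn _) (leq_addr _ _)) Nt
      (Dt n0 (leq_trans (leqnSn _) (leq_addr _ _))).
  have E' : d ^+ (n0.+1 + k) * (t - d * t') = s.
    apply: (mulfI d0); rewrite mulrA -exprS -addnS mulrBr -E -Ey.
    by rewrite mulrA -exprSr; ring.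
  have Mdt' : M (d * t') by exact: submodM sM _ _.
  have [|t'' Mt'' At''] := IH (t - d * t') (submodB sM Mt Mdt'); first by rewrite E'.
  exists (t' + t''); first exact: submodD sM _ _.
  by have -> : t - d * (t' + t'') = t - d * t' - d * t'' by ring.
(* Every class of M/dM has a representative in c^-1 A, so a submodule [N] containing dM is
   determined by the ideal of the elements of [A] in cN. *)
pose c := d ^+ n0.+1.
have MD t : M t -> exists2 t', M t' & A (c * (t - d * t')).
  move=> Mt; have [n] := tM _ Mt d md; have [le|/ltnW le] := leqP n n0.+1.
    move=> An; exists 0; first exact: submod0 sM.
    rewrite mulr0 subr0 /c -(subnK le) exprD -mulrA.
    by apply: subringM => //; exact: subringX.
  by rewrite -(subnKC le); exact: key.
move=> Phi [N0 PN0] h.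
have [||_ [N1 PN1 <-] maxN] := nA (Phi := [set [set u | A u /\ scale c N u] | N in Phi]).
- by exists [set u | A u /\ scale c N0 u], N0.
- move=> _ [N1 /h[sN1 _ _] <-]; have sc := submod_scale c sN1; split.
  + split; first by split; [exact: subring0 | exact: submod0 sc].
      by move=> x y [Ax sx] [Ay sy]; split; [exact: subringB | exact: submodB sc _ _].
    by move=> r x Ar [Ax sx]; split; [exact: subringM | exact: submodM sc _ _].
  + by move=> _ ->; split; [exact: subring0 | exact: submod0 sc].
  + by move=> x [].
exists N1 => // N2 PN2 N12 t N2t.
have [sN1 LN1 _] := h _ PN1; have [sN2 LN2 N2M] := h _ PN2.
have [t' Mt' Act'] := MD _ (N2M _ N2t).
have : [set u | A u /\ scale c N1 u] (c * (t - d * t')).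
  apply: (maxN [set u | A u /\ scale c N2 u]); first by exists N2.
    by move=> u [Au [v N1v Eu]]; split=> //; exists v => //; exact: N12.
  split=> //; exists (t - d * t') => //; apply: (submodB sN2 N2t).
  by apply: LN2; exists t'.
case=> _ [v N1v /mulfI -/(_ (expf_neq0 _ d0)) Ev].
rewrite -(subrK (d * t') t) -Ev; apply: (submodD sN1) => //.
by apply: LN1; exists t'.
Qed.

End Torsion.

(** * Integral elements and one-dimensional local rings *)

Section Integral.
Variable F : fieldType.
Implicit Types (A B I L M N P T V W : set F) (x y z : F).

(** A monic equation solved for its leading term; [n] = 0 would read 1 = 0, so it never occurs. All
    values of [w] must lie in [A], including those from [n] on. *)
Definition int_over A x := exists n (w : nat -> F),
  (forall i, A (w i)) /\ x ^+ n = \sum_(i < n) w i * x ^+ i.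

Lemma subring_sum A n (f : 'I_n -> F) : subring A -> (forall i, A (f i)) ->
  A (\sum_i f i).
Proof.
by move=> hA hf; apply: big_ind => //; [exact: subring0 | move=> *; exact: subringD].
Qed.

(** Dividing the equation by x to one less than its degree writes [x] as a polynomial in [x^-1] over
    [A]. *)
Lemma int_over_mem A V x : subring V -> A `<=` V -> int_over A x -> V x^-1 -> V x.
Proof.
move=> hV AV [n [w [Aw E]]] Vx; have [->|x0] := eqVneq x 0; first exact: subring0.
case: n E => [|n] E.
  by move: E; rewrite big_ord0 expr0 => /eqP; rewrite oner_eq0.
have -> : x = \sum_(i < n.+1) w i * x^-1 ^+ (n - i).
  apply: (mulIf (expf_neq0 n x0)); rewrite -exprS E big_distrl /=.
  apply: eq_bigr => i _; rewrite -mulrA; congr (_ * _).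
  have le : (i <= n)%N by rewrite -ltnS.
  have -> : x ^+ n = x ^+ (n - i) * x ^+ i by rewrite -exprD subnK.
  by rewrite mulrA -exprMn mulVf // expr1n mul1r.
by apply: subring_sum => // i; apply: subringM => //; [exact: AV | exact: subringX].
Qed.

(** Once powers of [x] are cancelled, the constant coefficient [w 0] is nonzero, and it is [x] times
    a polynomial in [x] over [A]. *)
Lemma int_over_multiple A x : subring A -> int_over A x -> x != 0 ->
  exists x', [/\ A (x * x'), x * x' != 0
    & forall V, subring V -> A `<=` V -> V x -> V x'].
Proof.
move=> hA [n [w [Aw E]]] x0; elim: n w Aw E => [|n IH] w Aw E.
  by move: E; rewrite big_ord0 expr0 => /eqP; rewrite oner_eq0.
pose y := x ^+ n - \sum_(i < n) w i.+1 * x ^+ i.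
have Ey : x * y = w 0.
  rewrite mulrBr -exprS E big_ord_recl expr0 mulr1 big_distrr /=.
  rewrite -addrA -sumrB big1 ?addr0 // => i _.
  by rewrite /bump /= add1n exprS; ring.
have [w0|w0] := eqVneq (w 0) 0.
  apply: (IH (fun i => w i.+1)) => //; apply/eqP; rewrite -subr_eq0 -/y.
  by move/eqP: Ey; rewrite w0 mulf_eq0 (negPf x0).
exists y; rewrite Ey; split=> // V hV AV Vx.
apply: subringB => //; first exact: subringX.
by apply: subring_sum => // i; apply: subringM => //; [exact: AV | exact: subringX].
Qed.

(* The maximal ideal of V when V is local; it contains 0 in spite of 0^-1 = 0. *)
Definition nonunit V : set F := [set v | V v /\ (v != 0 -> ~ V v^-1)].

Lemma subrXX_mem V v u n : subring V -> V v -> V u ->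
  exists2 s, V s & v ^+ n - u ^+ n = (v - u) * s.
Proof.
move=> hV Vv Vu; elim: n => [|n [s Vs E]].
  by exists 0; [exact: subring0 | rewrite !expr0 mulr0 subrr].
exists (v ^+ n + u * s).
  by apply: subringD => //; [exact: subringX | exact: subringM].
have -> : v ^+ n.+1 - u ^+ n.+1 = (v - u) * v ^+ n + u * (v ^+ n - u ^+ n).
  by rewrite !exprS; ring.
by rewrite E; ring.
Qed.

(** For additivity, let [v] and [w] be nonunits and u = v - w a unit: [w] divides some v^n, hence
    also u^n, so [w] would be a unit. *)
Lemma dim1_nonunit V : dim1 V -> prime_in V (nonunit V).
Proof.
move=> [hV d1]; split; first split.
- by split; [exact: subring0 | rewrite eqxx].
- move=> v w [Vv nv] [Vw nw]; split; first exact: subringB.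
  move=> u0 Vu; have [w0|w0] := eqVneq w 0.
    by move: u0 Vu; rewrite w0 subr0.
  have [v0|v0] := eqVneq v 0.
    apply: (nw w0); rewrite v0 sub0r invrN in Vu.
    by rewrite -[w^-1]opprK; exact: subringN.
  have [n Vn] := d1 v w Vv Vw (nv v0).
  have Vvw : V (v - w) by exact: subringB.
  have [s Vs E] := subrXX_mem n hV Vv Vvw.
  apply: (nw w0).
  have un0 : (v - w) ^+ n != 0 by rewrite expf_neq0.
  have -> : w^-1 = (v ^+ n / w - s) * (v - w)^-1 ^+ n.
    rewrite exprVn; apply: (mulIf un0); rewrite -mulrA mulVf // mulr1.
    have -> : (v - w) ^+ n = v ^+ n - w * s.
      have -> : w * s = v ^+ n - (v - w) ^+ n by rewrite E; ring.
      by rewrite subKr.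
    by field.
  by apply: subringM => //; [exact: subringB | exact: subringX].
- move=> r v Vr [Vv nv]; split; first exact: subringM.
  move=> rv0 Vrv; move: rv0; rewrite mulf_eq0 negb_or => /andP[r0 v0].
  apply: (nv v0); have -> : v^-1 = r * (r * v)^-1 by rewrite invfM mulVKf.
  exact: subringM.
- by move=> v [].
- by move=> [_]; rewrite invr1 oner_eq0 => /(_ isT); apply; exact: subring1.
- move=> x y Vx Vy [_ nxy]; have [[]|nx] := pselect (x != 0 /\ V x^-1).
    move=> x0 Vxi; right; split=> // y0 Vyi; apply: nxy.
      by rewrite mulf_neq0.
    by rewrite invfM; exact: subringM.
  by left; split=> // x0 Vxi; apply: nx.
Qed.

Lemma prime_in_sub V S P : S `<=` V -> subring S -> prime_in V P ->
  prime_in S (S `&` P).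
Proof.
move=> SV hS [sP PV P1 pP]; split; first split.
- by split; [exact: subring0 | exact: submod0 sP].
- by move=> x y [Sx Px] [Sy Py]; split; [exact: subringB | exact: submodB sP _ _].
- move=> r x Sr [Sx Px]; split; first exact: subringM.
  by apply: (submodM sP) => //; exact: SV.
- by move=> x [].
- by case.
- move=> x y Sx Sy [_ /(pP _ _ (SV _ Sx) (SV _ Sy))[]]; first by left.
  by right.
Qed.

Lemma loc_subring T P B : subring T -> prime_in T P -> subring B ->
  T `<=` B -> subring (loc T P B).
Proof.
move=> hT [sP PT P1 pP] hB TB; split.
- by exists 1; rewrite mulr1; split; [exact: subring1 | | exact: subring1].
- move=> x y [s [Ts nPs Bx]] [t [Tt nPt By]]; exists (s * t); split.
  + exact: subringM.
  + by move=> /(pP _ _ Ts Tt)[].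
  + have -> : s * t * (x - y) = t * (s * x) - s * (t * y) by ring.
    by apply: subringB => //; apply: subringM => //; exact: TB.
- move=> x y [s [Ts nPs Bx]] [t [Tt nPt By]]; exists (s * t); split.
  + exact: subringM.
  + by move=> /(pP _ _ Ts Tt)[].
  + by rewrite mulrACA; exact: subringM.
Qed.

Lemma sub_loc T P M : subring T -> prime_in T P -> M `<=` loc T P M.
Proof.
by move=> hT [_ _ P1 _] x Mx; exists 1; rewrite mul1r; split=> //; exact: subring1.
Qed.

(** For [v] in [P], [dim1] puts some s v^n with [s] outside [P] into xT, hence into [P0]; so [v]
    lies in [P0]. *)
Lemma dim1_loc_minimal T P P0 x : subring T -> prime_in T P ->
  dim1 (loc T P T) -> prime_in T P0 -> P0 `<=` P -> P0 x -> x != 0 ->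
  P `<=` P0.
Proof.
move=> hT pP [hV d1] [sP0 P0T P01 pP0] P0P P0x x0 v Pv.
have [sP PT P1 _] := pP.
have [->|v0] := eqVneq v 0; first exact: submod0 sP0.
have TV : T `<=` loc T P T by exact: sub_loc.
have [||[s [Ts nPs Ts']]|n [s [Ts nPs Ts']]] := d1 v x.
- by apply: TV; exact: PT.
- by apply: TV; exact: P0T.
- apply: nPs; have -> : s = (s * v^-1) * v by field.
  exact: submodM sP _ _.
have nP0s : ~ P0 s by move/P0P.
have : P0 (s * v ^+ n).
  have -> : s * v ^+ n = (s * (v ^+ n / x)) * x by field.
  exact: submodM sP0 _ _.
have Tv := PT _ Pv.
move=> /(pP0 _ _ Ts (subringX n hT Tv))[/nP0s //|].
elim: n {Ts'} => [//|n IH].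
by rewrite exprS => /(pP0 _ _ Tv (subringX n hT Tv))[].
Qed.

End Integral.

(** * A discrete valuation ring avoiding a nonintegral element *)

Section DVR.
Variable F : fieldType.
Variables A m Nu B : set F.
Hypotheses (hA : subring A) (hm : prime_in A m).
Hypothesis mV : forall x, A x -> ~ m x -> A x^-1.
Hypothesis nA : noeth A [set 0] A.
Hypotheses (hNu : subring Nu) (ANu : A `<=` Nu).
Hypothesis Nu_int : forall x, Nu x -> int_over A x.
Hypothesis int_Nu : forall x, int_over Nu x -> Nu x.
Hypothesis fracA : forall x, exists a b, [/\ A a, A b, b != 0 & x = a / b].
Hypotheses (hB : subring B) (AB : A `<=` B).
Variables c r0 y : F.
Hypotheses (Ac : A c) (c0 : c != 0) (cB : forall b, B b -> A (c * b)).
Hypotheses (mr0 : m r0) (r00 : r0 != 0).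
Hypotheses (nNuy : ~ Nu y) (my : forall r, m r -> B (r * y) /\ Nu (r * y)).

Let mA : m `<=` A. Proof. by case: hm. Qed.
Let mB : m `<=` B. Proof. exact: subset_trans AB. Qed.
Let W := tors m B `&` Nu.
Let T := tors m A `&` Nu.

Lemma subringI (V V' : set F) : subring V -> subring V' -> subring (V `&` V').
Proof.
move=> h h'; split; first by split; exact: subring1.
- by move=> x z [? ?] [? ?]; split; exact: subringB.
- by move=> x z [? ?] [? ?]; split; exact: subringM.
Qed.

Let hW : subring W. Proof. by apply: subringI => //; exact: tors_subring. Qed.
Let hT : subring T. Proof. by apply: subringI => //; exact: tors_subring. Qed.
Let AT : A `<=` T.
Proof. by move=> x Ax; split; [exact: sub_tors | exact: ANu]. Qed.
Let TW : T `<=` W.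
Proof.
move=> x [tx Nx]; split=> // r mr; have [n An] := tx r mr; exists n; exact: AB.
Qed.
Let AW : A `<=` W. Proof. exact: subset_trans TW. Qed.
Let cW x : W x -> T (c * x).
Proof.
move=> [tx Nx]; split; last by apply: subringM => //; exact: ANu.
by move=> r mr; have [n Bn] := tx r mr; exists n; rewrite mulrCA; exact: cB.
Qed.

(** Some multiple [d] of [x] in [W] is a nonzero element of [A], and cW lies in [T]; so W/dW is
    isomorphic to a subquotient of T/cdT, to which [noeth_tors] applies. *)
Let nW x : W x -> x != 0 -> noeth A (scale x W) W.
Proof.
move=> Wx x0; have [x' [Ad d0 hx']] := int_over_multiple hA (Nu_int Wx.2) x0.
have Wx' : W x' by exact: hx'.
pose d := x * x'.
have le : scale d W `<=` scale x W.
  by move=> _ [w Ww <-]; exists (x' * w); [exact: subringM | rewrite mulrA].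
apply: (noeth_mono le (@subset_refl _ W)).
apply: (noeth_scale c0).
have nT : noeth A (scale (c * d) T) T.
  apply: (noeth_tors hA hm mV nA).
  - exact: subring_submod.
  - by move=> t [].
  - exact: subringM.
  - by rewrite mulf_neq0.
apply: noeth_mono nT.
- by move=> _ [t Tt <-]; exists (d * t); [exists t => //; exact: TW | rewrite mulrA].
- by move=> _ [w Ww <-]; exact: cW.
Qed.

(** The [W]-modules spanned by x, ..., z^n x lie between xW and [W], so they stabilize; cancelling
    [x] leaves an integral equation for [z]. *)
Let almost_int z x : W x -> x != 0 -> (forall i, W (z ^+ i * x)) -> Nu z.
Proof.
move=> Wx x0 hz.
pose N n := [set u | exists w : nat -> F,
  (forall i, W (w i)) /\ u = \sum_(i < n.+1) w i * z ^+ i * x].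
have [n|n u|n hn] := noeth_chain (N := N) (nW Wx x0).
- split; first split.
  + exists (fun=> 0); split=> [_|]; first exact: subring0.
    by rewrite big1 // => i _; rewrite !mul0r.
  + move=> _ _ [w [Ww ->]] [w' [Ww' ->]]; exists (fun i => w i - w' i).
    split=> [i|]; first exact: subringB.
    by rewrite -sumrB; apply: eq_bigr => i _; ring.
  + move=> r _ Ar [w [Ww ->]]; exists (fun i => r * w i).
    split=> [i|]; first by apply: subringM => //; exact: AW.
    by rewrite big_distrr /=; apply: eq_bigr => i _; ring.
  + move=> _ [w Ww <-]; exists (fun i => if i == 0%N then w else 0).
    split=> [i|]; first by case: ifP => // _; exact: subring0.
    by rewrite big_ord_recl big1 ?addr0 => [|i _]; rewrite /= ?expr0; ring.
  + move=> _ [w [Ww ->]]; apply: subring_sum => // i.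
    by rewrite -mulrA; exact: subringM.
- move=> [w [Ww ->]]; exists (fun i => if (i < n.+1)%N then w i else 0).
  split=> [i|]; first by case: ifP => // _; exact: subring0.
  rewrite [RHS]big_ord_recr /= ltnn !mul0r addr0.
  by apply: eq_bigr => i _; rewrite ltn_ord.
have [|w [Ww E]] := hn (z ^+ n.+1 * x).
  exists (fun i => if i == n.+1 then 1 else 0).
  split=> [i|]; first by case: ifP => _; [exact: subring1 | exact: subring0].
  rewrite big_ord_recr /= eqxx big1 ?add0r ?mul1r // => i _.
  by rewrite ltn_eqF // !mul0r.
apply: int_Nu; exists n.+1, w; split=> [i|]; first by case: (Ww i).
by apply: (mulIf x0); rewrite E big_distrl.
Qed.

Lemma tors_dvr : exists P, [/\ prime_in T P, m `<=` P, dim1 (loc T P T),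
  Nu `<=` loc T P T & ~ loc T P T y].
Proof.
have tB : subring (tors m B) by exact: tors_subring.
have ty : tors m B y by move=> r /my[By _]; exists 1.
have Wr0 : W r0 by apply: AW; exact: mA.
pose C x := [set u | W u /\ W (u * x)].
(* As [r0 * y] lies in [W], every (W : wy) lies between r0W and [W], so a maximal one exists. *)
have [||_ [w [Ww nWwy <-]] maxC] := nW Wr0 r00
  (Phi := [set J | exists w, [/\ W w, ~ W (w * y) & C (w * y) = J]]).
- exists (C (1 * y)), 1; split=> //; first exact: subring1.
  by rewrite mul1r => -[].
- move=> _ [w [Ww nWwy <-]]; split.
  + by apply: (submod_sub AW); apply: submod_colon => //; exact: subring_submod.
  + move=> _ [u Wu <-]; split; first exact: subringM.
    have -> : r0 * u * (w * y) = (u * w) * (r0 * y) by ring.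
    apply: subringM => //; first exact: subringM.
    by have [Br Nr] := my mr0; split=> //; exact: sub_tors.
  + by move=> u [].
pose z := w * y; pose Q := C z.
have tz : tors m B z by case: Ww => tw _; exact: (subringM tB tw ty).
have nNuz : ~ Nu z by move=> Nz; apply: nWwy; split.
have sQ : submod W Q by apply: submod_colon => //; exact: subring_submod.
have QW : Q `<=` W by move=> u [].
have nQ1 : ~ Q 1 by rewrite /Q => -[_]; rewrite mul1r.
have pQ : prime_in W Q.
  split=> // u v Wu Wv Quv; have [Wuz|nWuz] := pselect (W (u * z)).
    by left.
  right; have : C ((u * w) * y) `<=` Q.
    apply: maxC.
      by exists (u * w); split=> //; [exact: subringM | rewrite -mulrA].
    by move=> t [Wt Wtz]; split=> //; rewrite -mulrA mulrCA; exact: subringM.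
  apply; split=> //; case: Quv => _.
  by rewrite [u * v]mulrC -!mulrA.
have mQ : m `<=` Q.
  move=> r mr; split; first by apply: AW; exact: mA.
  have -> : r * z = w * (r * y) by rewrite /z; ring.
  by apply: subringM => //; have [Br Nr] := my mr; split=> //; exact: sub_tors.
have z0 : z != 0 by apply/eqP => zz; apply: nNuz; rewrite zz; exact: subring0.
have /andP[w0 y0] : (w != 0) && (y != 0) by rewrite -negb_or -mulf_eq0.
(* [n] is the order of [x] for the valuation with uniformizer 1/z; if there were none, all z^i x
   would lie in [W] and [almost_int] would put [z] into [Nu]. *)
have ord x : W x -> x != 0 -> exists n, [/\ W (z ^+ n * x), ~ Q (z ^+ n * x)
    & forall i, (i < n)%N -> Q (z ^+ i * x)].
  move=> Wx x0; apply: contrapT => /forallNP h; apply: nNuz.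
  have h' n : W (z ^+ n * x) /\ forall i, (i < n)%N -> Q (z ^+ i * x).
    elim: n => [|n [Wn Qn]]; first by rewrite expr0 mul1r.
    have Qzn : Q (z ^+ n * x) by apply: contrapT => nQ; apply: (h n).
    split; first by case: Qzn => _; rewrite mulrC mulrA -exprS.
    by move=> i; rewrite ltnS leq_eqVlt => /orP[/eqP->|/Qn].
  by apply: (almost_int Wx x0) => i; case: (h' i).
have zQ n u : Q u -> W ((z * u) ^+ n).
  by move=> [Wu Wuz]; apply: subringX => //; rewrite mulrC.
pose V := loc W Q W.
have hV : subring V by exact: loc_subring.
have WV : W `<=` V by exact: sub_loc.
have unitV u : W u -> ~ Q u -> V u^-1.
  move=> Wu nQu; have u0 : u != 0.
    by apply/eqP => u0; apply: nQu; rewrite u0; exact: submod0 sQ.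
  by exists u; rewrite divff //; split=> //; exact: subring1.
(* The order of [r0] is positive because [r0] lies in [Q]; so 1/z is z^n r0 divided by the unit
   z^(n+1) r0. *)
have zV : V z^-1.
  have [[|n] [Wn nQn Qn]] := ord r0 Wr0 r00.
    by case: nQn; rewrite expr0 mul1r; exact: mQ.
  have -> : z^-1 = z ^+ n * r0 * (z ^+ n.+1 * r0)^-1.
    by rewrite exprS; field; rewrite expf_neq0 ?r00 ?z0.
  apply: subringM => //; last exact: unitV.
  by apply/WV/QW/Qn.
have d1V : dim1 V.
  split=> // v w' [s [Ws nQs Wsv]] [t [Wt nQt Wtw]] nVv.
  have s0 : s != 0 by apply/eqP => e; apply: nQs; rewrite e; exact: submod0 sQ.
  have t0 : t != 0 by apply/eqP => e; apply: nQt; rewrite e; exact: submod0 sQ.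
  have v0 : v != 0 by apply/eqP => e; apply: nVv; rewrite e invr0; exact: subring0.
  have [->|w'0] := eqVneq w' 0; first by exists 0; rewrite invr0 mulr0; exact: subring0.
  have Qsv : Q (s * v).
    apply: contrapT => nQ; apply: nVv.
    have -> : v^-1 = s * (s * v)^-1 by rewrite invfM mulVKf.
    by apply: subringM => //; [exact: WV | exact: unitV].
  (* As z s v lies in [W], v^n is divisible by z^-n in [V]; the order of [t * w'] is the exponent
     that suffices. *)
  have [n [Wn nQn _]] := ord _ Wtw (mulf_neq0 t0 w'0).
  exists n.
  have -> : v ^+ n / w' = (z * (s * v)) ^+ n * s^-1 ^+ n * t *
      (z ^+ n * (t * w'))^-1.
    rewrite !exprMn exprVn; field.
    by rewrite w'0 t0 !expf_neq0.
  apply: subringM => //; last exact: unitV.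
  apply: subringM; [exact: hV| |exact: WV]; apply: subringM => //.
    by apply: WV; exact: zQ.
  by apply: subringX => //; exact: unitV.
have fracW x : exists u v, [/\ W u, W v, v != 0 & x = u / v].
  have [u [v [Au Av v0 E]]] := fracA x.
  by exists u, v; split=> //; exact: AW.
have znV : ~ V z by move=> [s [Ws nQs Wsz]]; apply: nQs.
have zX k j : (j <= k)%N -> V (z ^+ j / z ^+ k).
  move=> /subnK <-; rewrite exprD invfM mulrCA divff ?expf_neq0 // mulr1.
  by rewrite -exprVn; exact: subringX.
(* Comparing the orders of [u] and [v] shows that [x] or its inverse lies in [V]; in the second case
   integrality of [x] gives the claim. *)
have NuV : Nu `<=` V.
  move=> x Nx; have [->|x0] := eqVneq x 0; first exact: subring0.
  have [u [v [Wu Wv v0 E]]] := fracW x.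
  have u0 : u != 0 by apply: contra_neq x0 => u0; rewrite E u0 mul0r.
  have [n [Wn nQn _]] := ord u Wu u0; have [k [Wk nQk _]] := ord v Wv v0.
  have [kn|/ltnW nk] := leqP k n.
    have -> : x = (z ^+ k / z ^+ n) * ((z ^+ n * u) * (z ^+ k * v)^-1).
      by rewrite E; field; rewrite !expf_neq0 ?v0.
    by apply: subringM (zX _ _ kn) _ => //; apply: subringM => //; [exact: WV | exact: unitV].
  apply: (int_over_mem hV _ (Nu_int Nx)); first exact: subset_trans WV.
  have -> : x^-1 = (z ^+ n / z ^+ k) * ((z ^+ k * v) * (z ^+ n * u)^-1).
    by rewrite E; field; rewrite !expf_neq0 ?v0 ?u0.
  by apply: subringM (zX _ _ nk) _ => //; apply: subringM => //; [exact: WV | exact: unitV].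
(* With [n] the order of [c], the element g = z^n c is outside [Q] and multiplies [W] into [T], so
   localizing [W] at [Q] and [T] at its contraction gives the same ring. *)
have [n [Wg nQg _]] := ord c (AW Ac) c0.
pose g := z ^+ n * c.
have gW x : W x -> T (g * x).
  move=> Wx; have Wgx : W (g * x) by exact: subringM.
  split; last by case: Wgx.
  move=> r mr; have Wzr : W ((z * r) ^+ n) by apply: zQ; exact: mQ.
  have [k Ak] := (cW (subringM hW Wzr Wx)).1 r mr.
  exists (k + n)%N; have -> : r ^+ (k + n) * (g * x) = r ^+ k * (c * ((z * r) ^+ n * x)).
    
    by rewrite /g exprD (exprMn _ z); move: (z ^+ n) => zn; ring.
  by [].
have Tg : T g by rewrite -[g]mulr1; apply: gW; exact: subring1.
exists (T `&` Q).
have -> : loc T (T `&` Q) T = V.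
  apply/seteqP; split=> x [s [Ss nQs Tsx]].
    by exists s; split; [exact: TW | move=> Qs; apply: nQs | exact: TW].
  exists (g * s); split; [exact: gW | | by rewrite -mulrA; exact: gW].
  have [_ _ _ pr] := pQ.
  by move=> [_ /(pr _ _ (TW Tg) Ss)[]].
split=> //.
- exact: prime_in_sub TW hT pQ.
- by move=> r mr; split; [apply: AT; exact: mA | exact: mQ].
- move=> [s [Ws nQs Wsy]]; apply: nQs; split=> //.
  by rewrite mulrCA; exact: subringM.
Qed.

End DVR.

(** * Adjoining elements with a common denominator *)

Section Adjoin.
Variable F : fieldType.
Implicit Types (A B I L M N P T V W : set F) (x y z : F).

(** This replaces induction on a list of generators: a maximal [N] satisfying [G] absorbs every [x]
    of [M]. *)
Lemma submod_ind A M (G : set F -> Prop) : subring A -> noeth A [set 0] A ->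
  submod A M -> M `<=` A -> G [set 0] ->
  (forall N x, submod A N -> N `<=` M -> M x -> G N ->
     G [set n + r * x | n in N & r in A]) -> G M.
Proof.
move=> hA nA sM MA G0 step.
have s0 : submod A [set 0].
  by split=> [//|_ _ -> ->|r _ _ ->]; rewrite ?subrr ?mulr0.
have [||N [[sN NM] GN] maxN] := nA [set N | [/\ submod A N & N `<=` M] /\ G N].
- by exists [set 0]; split=> //; split=> // _ ->; exact: submod0 sM.
- move=> N [[sN NM] _]; split=> //; last exact: subset_trans MA.
  by move=> _ ->; exact: submod0 sN.
suff MN : M `<=` N by have -> : M = N by apply/seteqP.
move=> x Mx; apply: (maxN [set n + r * x | n in N & r in A]).
- split; last exact: step.
  split; first exact: submod_adjoin.
  by move=> _ [n Nn [r Ar <-]]; apply: (submodD sM); [exact: NM | exact: submodM sM _ _].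
- exact: adjoin_sub.
- exact: adjoin_mem.
Qed.

(** The power b^n, with [n] the degree of the equation, clears x^e for e up to [n]; higher powers
    reduce to lower ones by the equation. *)
Lemma int_over_denominator A x a b : subring A -> A a -> A b -> b != 0 -> x = a / b ->
  int_over A x -> exists c, [/\ A c, c != 0 & forall e, A (c * x ^+ e)].
Proof.
move=> hA Aa Ab b0 Ex [n [w [Aw E]]]; exists (b ^+ n).
split; [exact: subringX | by rewrite expf_neq0|].
elim/ltn_ind=> e IH; have [le|lt] := leqP e n.
  have -> : b ^+ n * x ^+ e = b ^+ (n - e) * a ^+ e.
    rewrite -(subnK le) exprD addnK Ex -mulrA; congr (_ * _).
    by rewrite expr_div_n mulrC divfK // expf_neq0.
  by apply: subringM => //; exact: subringX.
have le := ltnW lt; rewrite -(subnK le) exprD E big_distrr big_distrr /=.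
apply: subring_sum => // i.
have -> : b ^+ n * (x ^+ (e - n) * (w i * x ^+ i)) =
    w i * (b ^+ n * x ^+ (e - n + i)) by rewrite exprD; ring.
by apply: subringM => //; apply: IH; rewrite -ltn_subRL subKn.
Qed.

Lemma adjoin_conductor A B c x c' : subring A -> subring B -> A `<=` B ->
  c != 0 -> A c -> (forall b, B b -> A (c * b)) ->
  c' != 0 -> A c' -> (forall e, A (c' * x ^+ e)) ->
  exists B' c'', [/\ subring B', B `<=` B', B' x & [/\ A c'', c'' != 0
    & forall b, B' b -> A (c'' * b)]].
Proof.
move=> hA hB AB c0 Ac cB c'0 Ac' hc'.
(* B' is the multiplier ring of the ideal J, which contains c * c'. *)
pose J : set F := [set j | forall b e, B b -> A (j * b * x ^+ e)].
pose B' : set F := [set b | forall j, J j -> J (b * j)].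
have Jc : J (c * c').
  move=> b e Bb; have -> : c * c' * b * x ^+ e = (c * b) * (c' * x ^+ e) by ring.
  by apply: subringM => //; exact: cB.
exists B', (c * c'); split.
- split; first by move=> j; rewrite mul1r.
  + move=> u v hu hv j Jj b e Bb.
    have -> : (u - v) * j * b * x ^+ e = u * j * b * x ^+ e - v * j * b * x ^+ e by ring.
    by apply: subringB => //; [exact: hu | exact: hv].
  + by move=> u v hu hv j Jj; rewrite -mulrA; apply: hu; exact: hv.
- move=> b Bb j Jj b' e Bb'; rewrite [b * j]mulrC -[j * b * b']mulrA; apply: Jj.
  exact: subringM.
- move=> j Jj b e Bb; have -> : x * j * b * x ^+ e = j * b * x ^+ e.+1.
    by rewrite exprS; ring.
  exact: Jj.
- split; [exact: subringM | by rewrite mulf_neq0|].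
  move=> b /(_ _ Jc)/(_ 1 0)/(_ (subring1 hB)).
  by rewrite expr0 !mulr1 mulrC.
Qed.

(** The prime is the contraction to [S] of the maximal ideal of [V]. *)
Lemma dim1_eq_loc S V : dim1 V -> subring S -> S `<=` V ->
  (forall x, V x -> exists s, [/\ S s, s != 0, V s^-1 & S (s * x)]) ->
  exists2 P, prime_in S P & V = loc S P S.
Proof.
move=> d1 hS SV hV; have [rV _] := d1.
exists (S `&` nonunit V); first exact: prime_in_sub SV hS (dim1_nonunit d1).
apply/seteqP; split=> x.
  by move=> /hV[s [Ss s0 Vs Ssx]]; exists s; split=> // -[_ [_]]; exact.
move=> [s [Ss nP Ssx]].
have [s0 Vs] : s != 0 /\ V s^-1.
  by apply: contrapT => h; apply: nP; split=> //; split; [exact: SV|]; move=> s0 Vs; exact: h.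
by rewrite -[x](mulKf s0); apply: subringM => //; exact: SV.
Qed.

End Adjoin.

(** * Localization at a prime *)

Section Localization.
Variable F : fieldType.
Variables R q : set F.
Hypotheses (hR : subring R) (pq : prime_in R q).

Let sq : submod R q. Proof. by case: pq. Qed.
Let qR : q `<=` R. Proof. by case: pq. Qed.
Let q1 : ~ q 1. Proof. by case: pq. Qed.
Let qM x y : R x -> R y -> ~ q x -> ~ q y -> ~ q (x * y).
Proof. by move=> Rx Ry nx ny; have [_ _ _ h] := pq; move=> /(h _ _ Rx Ry)[]. Qed.
Let nz s : ~ q s -> s != 0.
Proof. by move=> h; apply/eqP => s0; apply: h; rewrite s0; exact: submod0 sq. Qed.

Lemma loc_mono (M N : set F) : M `<=` N -> loc R q M `<=` loc R q N.
Proof. by move=> MN x [s [Rs nqs Mx]]; exists s; split=> //; exact: MN. Qed.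

Let A := loc R q R.
Let m := loc R q q.

Lemma loc_inv s : R s -> ~ q s -> A s^-1.
Proof. by move=> Rs nqs; exists s; rewrite divff ?nz //; split=> //; exact: subring1. Qed.

Lemma loc_maxP r : R r -> m r -> q r.
Proof.
move=> Rr [s [Rs nqs qsr]]; apply: contrapT => nqr.
by apply: (qM Rs Rr nqs nqr).
Qed.

Lemma loc_prime : prime_in A m.
Proof.
split; first split.
- by apply: (sub_loc hR pq); exact: submod0 sq.
- move=> x y [s [Rs nqs qx]] [t [Rt nqt qy]]; exists (s * t); split.
  + exact: subringM.
  + exact: qM.
  + have -> : s * t * (x - y) = t * (s * x) - s * (t * y) by ring.
    by apply: (submodB sq); exact: submodM sq _ _.
- move=> x y [s [Rs nqs Rx]] [t [Rt nqt qy]]; exists (s * t); split.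
  + exact: subringM.
  + exact: qM.
  + by rewrite mulrACA; exact: submodM sq _ _.
- exact: loc_mono.
- by move/(loc_maxP (subring1 hR)).
- move=> x y [s [Rs nqs Rx]] [t [Rt nqt Ry]] [u [Ru nqu qxy]].
  have [qx|nqx] := pselect (q (s * x)); first by left; exists s.
  right; exists t; split=> //; apply: contrapT => nqy.
  apply: (qM (subringM hR Ru Rx)) Ry _ nqy _; first exact: qM.
  have -> : u * (s * x) * (t * y) = (s * t) * (u * (x * y)) by ring.
  by apply: (submodM sq) => //; exact: subringM.
Qed.

Lemma loc_unit x : A x -> ~ m x -> A x^-1.
Proof.
move=> [s [Rs nqs Rx]] nmx; have nqx : ~ q (s * x) by move=> h; apply: nmx; exists s.
exists (s * x); split=> //; have := nz nqx; rewrite mulf_eq0 negb_or => /andP[_ x0].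
by rewrite mulfK.
Qed.

(** A submodule of [A] is recovered from its intersection with [R] by clearing denominators. *)
Lemma loc_noeth : noeth R [set 0] R -> noeth A [set 0] A.
Proof.
move=> nR Phi [N0 PN0] h.
have RA : R `<=` A by exact: sub_loc.
have [||_ [N PN <-] maxN] := nR [set N `&` R | N in Phi].
- by exists (N0 `&` R), N0.
- move=> _ [N /h[sN _ _] <-]; have sNR := submod_sub RA sN; split.
  + split; first by split; [exact: submod0 sN | exact: subring0].
      by move=> x y [Nx Rx] [Ny Ry]; split; [exact: submodB sN _ _ | exact: subringB].
    by move=> r x Rr [Nx Rx]; split; [exact: submodM sNR _ _ | exact: subringM].
  + by move=> _ ->; split; [exact: submod0 sN | exact: subring0].
  + by move=> x [].
exists N => // N' PN' NN' x N'x.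
have [sN _ _] := h _ PN; have [sN' _ N'A] := h _ PN'.
have [s [Rs nqs Rsx]] := N'A _ N'x.
have NNR : N `&` R `<=` N' `&` R by move=> u [Nu Ru]; split=> //; exact: NN'.
have [||] := maxN (N' `&` R) _ NNR (s * x).
- by exists N'.
- by split=> //; apply: (submodM sN') => //; exact: RA.
move=> Nsx _; rewrite -[x](mulKf (nz nqs)).
by apply: (submodM sN) => //; exact: loc_inv.
Qed.

Variable Nu : set F.
Hypotheses (hNu : subring Nu) (RNu : R `<=` Nu).

Lemma loc_int_over x : (forall x, Nu x -> int_over R x) ->
  loc R q Nu x -> int_over A x.
Proof.
move=> hint [s [Rs nqs /hint[n [w [Rw E]]]]].
exists n, (fun i => w i * s ^+ i * s^-1 ^+ n); split=> [i|].
  do ![apply: subringM; [exact: loc_subring | |]].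
  - exact: sub_loc.
  - by apply: (sub_loc hR pq); exact: subringX.
  - by apply: subringX; [exact: loc_subring | exact: loc_inv].
have s0 := nz nqs; have sn0 : s ^+ n != 0 by rewrite expf_neq0.
apply: (mulfI sn0); rewrite -exprMn E big_distrr /=; apply: eq_bigr => i _.
by rewrite exprMn exprVn; field.
Qed.

Lemma loc_int_closed x : (forall x, int_over Nu x -> Nu x) ->
  int_over (loc R q Nu) x -> loc R q Nu x.
Proof.
move=> hint [n [w [Nw E]]].
have [s [Rs nqs hs]] : exists s, [/\ R s, ~ q s
    & forall i, (i < n)%N -> Nu (s * w i)].
  elim: n {E} => [|n [s [Rs nqs hs]]].
    by exists 1; split=> //; exact: subring1.
  have [t [Rt nqt Nt]] := Nw n; exists (s * t); split.
  - exact: subringM.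
  - exact: qM.
  - move=> i; rewrite ltnS leq_eqVlt => /orP[/eqP->|/hs Ni].
      by rewrite -mulrA; apply: subringM => //; exact: RNu.
    by rewrite mulrAC mulrC; apply: subringM => //; exact: RNu.
exists s; split=> //; apply: hint.
(* The equation is multiplied by s^n. Coefficients from [n] on are set to 0, since [s] clears only
   those below [n]. *)
exists n, (fun i => if (i < n)%N then s ^+ (n - i) * w i else 0); split=> [i|].
  case: ifP => lt; last exact: subring0.
  rewrite -(ltn_predK lt) subSn; last by rewrite -ltnS (ltn_predK lt).
  rewrite exprSr -mulrA; apply: subringM => //; last exact: hs.
  by apply: subringX => //; exact: RNu.
rewrite exprMn E big_distrr /=; apply: eq_bigr => i _.
have le : (i <= n)%N by exact: ltnW.
rewrite ltn_ord exprMn; have -> : s ^+ n = s ^+ (n - i) * s ^+ i.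
  by rewrite -exprD subnK.
ring.
Qed.

End Localization.

(** * Primes of height one *)

Section HeightOne.
Variable F : fieldType.
Variable R : set F.
Hypotheses (hR : subring R) (nR : noeth R [set 0] R).

(** Height one as minimality among the nonzero primes; [height1P] relates this to chains. *)
Definition ht1 (p : set F) := [/\ prime_in R p, exists2 x, p x & x != 0
  & forall P, prime_in R P -> P `<=` p -> (exists2 x, P x & x != 0) -> p `<=` P].

(** Let [x] and [z] be numerators of [v] and [w]. If no v^n/w lay in R_p, an ideal containing [z]
    and maximal among those avoiding all u x^n with u outside [p] would be a nonzero prime inside
    [p] without [x], against minimality. *)
Lemma dim1_loc_ht1 (p : set F) : ht1 p -> dim1 (loc R p R).
Proof.
move=> [pp _ minp]; have [sp pR p1 pM] := pp.
have hV := loc_subring hR pp hR (@subset_refl _ R); split=> // v w [s [Rs nps Rsv]] [t [Rt npt Rtw]] nVv.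
have nz u : ~ p u -> u != 0.
  by move=> h; apply/eqP => u0; apply: h; rewrite u0; exact: submod0 sp.
have s0 := nz s nps; have t0 := nz t npt.
have [->|w0] := eqVneq w 0; first by exists 0; rewrite invr0 mulr0; exact: subring0.
pose x := s * v; pose z := t * w.
have z0 : z != 0 by exact: mulf_neq0.
have px : p x.
  apply: contrapT => npx; apply: nVv; exists x; split=> //.
  have v0 : v != 0 by have := nz x npx; rewrite mulf_eq0 negb_or => /andP[].
  by rewrite mulfK.
apply: contrapT => /forallNP h.
have [||I [sI IR Iz hI] maxI] := nR (Phi := [set I | [/\ submod R I, I `<=` R,
    I z & forall n u, R u -> ~ p u -> ~ I (u * x ^+ n)]]).
- exists (scale z R); split.
  + by apply: submod_scale; exact: subring_submod.
  + by move=> _ [r Rr <-]; exact: subringM.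
  + by exists 1; rewrite ?mulr1 //; exact: subring1.
  + move=> n u Ru npu [r Rr E]; apply: (h n); exists (u * s ^+ n).
    have npsn : ~ p (s ^+ n).
      elim: n {E} => [|n IH]; first by rewrite expr0.
      by rewrite exprS => /(pM _ _ Rs (subringX n hR Rs))[].
    split.
    * by apply: subringM => //; exact: subringX.
    * by move=> /(pM _ _ Ru (subringX n hR Rs))[].
    * have -> : u * s ^+ n * (v ^+ n / w) = r * t.
        apply: (mulfI z0); rewrite [RHS]mulrA E /z /x exprMn; field.
        by rewrite w0.
      exact: subringM.
- move=> I [sI IR _ _]; split=> //.
  by move=> _ ->; exact: submod0 sI.
have Ip : I `<=` p.
  move=> u Iu; apply: contrapT => npu.
  by apply: (hI 0 u (IR _ Iu) npu); rewrite expr0 mulr1.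
have pI : prime_in R I.
  split=> //; first by move/Ip.
  move=> u u' Ru Ru' Iuu'; apply: contrapT => /not_orP[nIu nIu'].
  have key y : R y -> ~ I y -> exists n s i r,
      [/\ R s, ~ p s, I i, R r & s * x ^+ n = i + r * y].
    move=> Ry nIy; apply: contrapT => hy; apply: nIy.
    apply: (maxI [set i + r * y | i in I & r in R]).
    - split.
      + exact: submod_adjoin.
      + by move=> _ [i Ii [r Rr <-]]; apply: subringD => //; [exact: IR | exact: subringM].
      + exact: adjoin_sub.
      + move=> n s' Rs' nps' [i Ii [r Rr E]]; apply: hy.
        by exists n, s', i, r; split.
    - exact: adjoin_sub.
    - exact: adjoin_mem.
  have [n [s1 [i [r [Rs1 nps1 Ii Rr E]]]]] := key u Ru nIu.
  have [k [s2 [j [r' [Rs2 nps2 Ij Rr' E']]]]] := key u' Ru' nIu'.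
  apply: (hI (n + k)%N (s1 * s2)); first exact: subringM.
    by move=> /(pM _ _ Rs1 Rs2)[].
  have -> : s1 * s2 * x ^+ (n + k) = (s1 * x ^+ n) * (s2 * x ^+ k).
    by rewrite exprD; ring.
  rewrite E E'.
  have -> : (i + r * u) * (j + r' * u') =
    (j + r' * u') * i + (r * u) * j + (r * r') * (u * u') by ring.
  apply: (submodD sI); last by apply: (submodM sI) => //; exact: subringM.
  apply: (submodD sI); apply: (submodM sI) => //; last exact: subringM.
  by apply: subringD => //; [exact: IR | exact: subringM].
have Ix : I x by apply: (minp I) => //; exists z.
by apply: (hI 1 1) => //; [exact: subring1 | rewrite mul1r expr1].
Qed.

End HeightOne.

(** * Finite character of R^sigma inside the fraction field *)

Section SigmaSet.
Variable F : fieldType.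
Variables R Nu : set F.
Hypotheses (hR : subring R) (nR : noeth R [set 0] R).
Hypotheses (hNu : subring Nu) (RNu : R `<=` Nu).
Hypothesis Nu_int : forall x, Nu x -> int_over R x.
Hypothesis int_Nu : forall x, int_over Nu x -> Nu x.
Hypothesis fracR : forall x, exists a b, [/\ R a, R b, b != 0 & x = a / b].

Definition sigma_set : set F := Nu `&` [set x | forall p, ht1 R p -> loc R p R x].

Lemma sigma_set_subring : subring sigma_set.
Proof.
split.
- split; first exact: subring1.
  by move=> p [pp _ _]; apply: sub_loc => //; exact: subring1.
- move=> x y [Nx hx] [Ny hy]; split; first exact: subringB.
  move=> p hp; have [pp _ _] := hp.
  by apply: subringB; [exact: loc_subring | exact: hx | exact: hy].
- move=> x y [Nx hx] [Ny hy]; split; first exact: subringM.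
  move=> p hp; have [pp _ _] := hp.
  by apply: subringM; [exact: loc_subring | exact: hx | exact: hy].
Qed.
Let hS := sigma_set_subring.

Lemma sub_sigma_set : R `<=` sigma_set.
Proof.
move=> x Rx; split; first exact: RNu.
by move=> p [pp _ _]; exact: sub_loc.
Qed.

Let T q := tors (loc R q q) (loc R q R) `&` loc R q Nu.

Section AtPrime.
Variable q : set F.
Hypothesis pq : prime_in R q.
Variable a : F.
Hypotheses (qa : q a) (a0 : a != 0).

Let A := loc R q R.
Let m := loc R q q.

Let sq : submod R q. Proof. by case: pq. Qed.
Let qR : q `<=` R. Proof. by case: pq. Qed.
Let hA : subring A. Proof. exact: loc_subring. Qed.
Let hm : prime_in A m. Proof. exact: loc_prime. Qed.
Let mA : m `<=` A. Proof. exact: loc_mono. Qed.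
Let nA : noeth A [set 0] A. Proof. exact: loc_noeth. Qed.
Let hNuq : subring (loc R q Nu). Proof. exact: loc_subring. Qed.
Let RA : R `<=` A. Proof. exact: sub_loc. Qed.
Let ANu : A `<=` loc R q Nu. Proof. exact: loc_mono. Qed.
Let ma : m a. Proof. exact: sub_loc. Qed.
Let hT : subring (T q).
Proof. by apply: subringI => //; exact: tors_subring. Qed.
Let AT : A `<=` T q.
Proof. by move=> x Ax; split; [exact: sub_tors | exact: ANu]. Qed.

Lemma loc_dim1_ht1 : dim1 A -> ht1 R q.
Proof.
move=> dA; split=> //; first by exists a.
by move=> P pP Pq [x Px x0]; exact: dim1_loc_minimal dA pP Pq Px x0.
Qed.

(** Each such [P] contains [a] and, by [dim1_loc_minimal], is minimal over it; T/aT is Noetherian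
    over [A], so finitely many [P] occur. *)
Lemma finite_dvr_at : finite_set [set V | exists P, [/\ prime_in (T q) P,
  m `<=` P, dim1 (loc (T q) P (T q)) & V = loc (T q) P (T q)]].
Proof.
have sT : submod A (T q) by exact: subring_submod.
have sTT : submod (T q) (scale a (T q)) by apply: submod_scale; exact: subring_submod.
have Ta : T q a by apply: AT; exact: mA.
have [||X fX hX] := finite_primes_over hA hT AT _ sTT.
- apply: (noeth_tors hA hm _ nA) => //; last exact: mA.
  + exact: loc_unit.
  + by move=> x [].
- by move=> _ [x Tx <-]; exact: subringM.
apply: (sub_finite_set _ (finite_image (fun P => loc (T q) P (T q)) fX)).
move=> _ [P [pP mP d1 ->]]; have [sP _ _ _] := pP.
have Pa : P a by exact: mP.
have [|P0 XP0 [pP0 aP0 P0P]] := hX P pP.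
  by move=> _ [x Tx <-]; rewrite mulrC; exact: submodM sP _ _.
exists P0 => //; suff -> : P = P0 by [].
apply/seteqP; split=> //.
apply: (dim1_loc_minimal hT pP d1 pP0 P0P _ a0).
by apply: aP0; exists 1; rewrite ?mulr1 //; exact: subring1.
Qed.

Hypothesis nht : ~ ht1 R q.

Lemma not_sub_ht1 p : ht1 R p -> ~ q `<=` p.
Proof.
move=> hp qp; apply: nht; have [_ _ minp] := hp.
suff -> : q = p by [].
by apply/seteqP; split=> //; apply: minp => //; exists a.
Qed.

(** A height-one prime [p] misses some generator x of [q], and x^n t lies in R_q. One [s] outside
    [q] clears these denominators for all generators, so s t lies in every R_p. *)
Lemma tors_sigma_set t : T q t -> exists s, [/\ R s, ~ q s & sigma_set (s * t)].
Proof.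
move=> [tt [s2 [Rs2 nqs2 Nt]]].
have q1 : ~ q 1 by case: pq.
have qM x y : R x -> R y -> ~ q x -> ~ q y -> ~ q (x * y).
  by move=> Rx Ry nx ny; have [_ _ _ h] := pq; move=> /(h _ _ Rx Ry)[].
have [s1 [Rs1 nqs1 h1]] : exists s, [/\ R s, ~ q s
    & forall p, ht1 R p -> ~ q `<=` p -> loc R p R (s * t)].
  apply: (submod_ind (G := fun N => exists s, [/\ R s, ~ q s
    & forall p, ht1 R p -> ~ N `<=` p -> loc R p R (s * t)]) hR nR sq qR).
    exists 1; split=> //; first exact: subring1.
    by move=> p [[sp _ _ _] _ _] []; move=> _ ->; exact: submod0 sp.
  move=> N x sN Nq qx [s [Rs nqs hs]].
  have [n [u [Ru nqu Rt]]] := tt x (sub_loc hR pq qx).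
  exists (s * u); split; [exact: subringM | exact: qM|].
  move=> p hp nNp; have [pp _ _] := hp; have [sp _ p1 pM] := pp.
  have hV := loc_subring hR pp hR (@subset_refl _ R).
  (* Either [N] already escapes [p], or the new generator [x] does and x^n serves as denominator. *)
  have [Np|nN] := pselect (N `<=` p); last first.
    rewrite mulrAC mulrC; apply: subringM => //; last exact: hs.
    exact: sub_loc.
  have npx : ~ p x.
    move=> px; apply: nNp => _ [y Ny [r Rr <-]].
    by apply: (submodD sp); [exact: Np | exact: submodM sp _ _].
  have Rx := qR qx.
  exists (x ^+ n); split; first exact: subringX.
    elim: (n) => [|k IH]; first by rewrite expr0.
    by rewrite exprS => /(pM _ _ Rx (subringX k hR Rx))[].
  have -> : x ^+ n * (s * u * t) = s * (u * (x ^+ n * t)) by ring.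
  exact: subringM.
exists (s2 * s1); split; [exact: subringM | exact: qM|]; split.
  by rewrite mulrAC mulrC; apply: subringM => //; exact: RNu.
move=> p hp; have [pp _ _] := hp; rewrite -mulrA.
apply: subringM; [exact: loc_subring | exact: sub_loc |].
by apply: h1 => //; exact: not_sub_ht1.
Qed.

Lemma dvr_sigma_set P : let V := loc (T q) P (T q) in prime_in (T q) P -> dim1 V ->
  loc R q Nu `<=` V -> exists2 Q, prime_in sigma_set Q & V = loc sigma_set Q sigma_set.
Proof.
move=> V pP d1 NV; have [hV _] := d1; have [sP _ _ _] := pP.
have SV : sigma_set `<=` V by move=> x [Nx _]; apply: NV; exact: sub_loc.
apply: dim1_eq_loc => // x [s [Ts nPs Tsx]].
have [u [Ru nqu Su]] := tors_sigma_set Ts; have [w [Rw nqw Sw]] := tors_sigma_set Tsx.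
have s0 : s != 0 by apply/eqP => s0; apply: nPs; rewrite s0; exact: submod0 sP.
have u0 : u != 0 by apply/eqP => e; apply: nqu; rewrite e; exact: submod0 sq.
have w0 : w != 0 by apply/eqP => e; apply: nqw; rewrite e; exact: submod0 sq.
(* The factors [u] and [w] push [s] and [s * x] into [sigma_set]; being outside [q], they are units
   of [V]. *)
exists (w * (u * s)); split.
- by apply: subringM => //; exact: sub_sigma_set.
- by rewrite !mulf_neq0.
- rewrite !invfM; do ![apply: subringM => //].
  + by apply/NV/ANu/loc_inv.
  + by apply/NV/ANu/loc_inv.
  + by exists s; rewrite divff //; split=> //; exact: subring1.
- have -> : w * (u * s) * x = u * (w * (s * x)) by ring.
  by apply: subringM => //; exact: sub_sigma_set.
Qed.

(** A socle element t of T(q)/R_q has annihilator qR_q, and multiplication by [a] turns it into an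
    element of R_q/aR_q with the same annihilator. If T(q) = R_q, then R_q is itself
    one-dimensional, against [nht]. *)
Lemma dvr_weak_assoc P : prime_in (T q) P -> m `<=` P ->
  dim1 (loc (T q) P (T q)) ->
  exists2 x, R x & weak_assoc R (scale a R) q x.
Proof.
move=> pP mP d1.
have [TA|nTA] := pselect (T q `<=` A).
  exfalso; apply: nht; apply: loc_dim1_ht1.
  suff E : loc (T q) P (T q) = A by rewrite -E.
  have TE : T q = A by apply/seteqP.
  rewrite TE; apply/seteqP; split=> x.
    move=> [s [As nPs Asx]]; have As' : A s^-1.
      by apply: loc_unit => //; move/mP.
    have s0 : s != 0.
      by apply/eqP => e; apply: nPs; rewrite e; case: pP => /submod0.
    by rewrite -[x](mulKf s0); exact: subringM.
  move=> Ax; exists 1; rewrite mul1r; split=> //; first exact: subring1.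
  by case: pP.
have sA : submod A A by exact: subring_submod.
have [|t [Tt nAt mt]] := socle hA hm nA sA (subring_submod AT hT) _ nTA.
  by move=> x r [tx _]; exact: tx.
have [s [Rs nqs Rat]] := mt a ma.
exists (s * (a * t)) => // r Rr; split.
  move=> qr; have [u [Ru nqu Rut]] := mt r (sub_loc hR pq qr).
  exists u; split=> //; exists (s * (u * (r * t))); first exact: subringM.
  by ring.
move=> [u [Ru nqu [w Rw E]]]; apply: contrapT => nqr; apply: nAt.
have Ew : w = r * u * s * t by apply: (mulfI a0); rewrite E; ring.
have [_ _ _ pM] := pq.
exists (r * u * s); split.
- by do ![apply: subringM => //].
- by move=> /(pM _ _ (subringM hR Rr Ru) Rs)[/(pM _ _ Rr Ru)[]|].
- by rewrite -Ew.
Qed.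

Lemma separate_at y : q = [set r | R r /\ sigma_set (r * y)] -> ~ sigma_set y ->
  exists P, [/\ prime_in (T q) P, m `<=` P, dim1 (loc (T q) P (T q)),
    loc R q Nu `<=` loc (T q) P (T q) & ~ loc (T q) P (T q) y].
Proof.
move=> Eq nSy.
have qy r : q r -> sigma_set (r * y) by rewrite {1}Eq => -[].
have fracA x : exists u v, [/\ A u, A v, v != 0 & x = u / v].
  by have [u [v [Ru Rv v0 E]]] := fracR x; exists u, v; split=> //; exact: RA.
have Nu_intq x : loc R q Nu x -> int_over A x by exact: loc_int_over.
(* The products r y, for one generator r of [q] after another, are adjoined to R_q; each lies in
   [Nu], which yields the denominator [c]. *)
have [B [c [[hB AB] [Ac c0 cB] By]]] : exists B c, [/\ subring B /\ A `<=` B,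
    [/\ A c, c != 0 & forall b, B b -> A (c * b)] & forall r, q r -> B (r * y)].
  apply: (submod_ind (G := fun N => exists B c, [/\ subring B /\ A `<=` B,
    [/\ A c, c != 0 & forall b, B b -> A (c * b)] & forall r, N r -> B (r * y)])
    hR nR sq qR).
    exists A, 1; split.
    - by split.
    - split; [exact: (subring1 hA) | exact: oner_neq0 |].
      by move=> b; rewrite mul1r.
    - by move=> _ ->; rewrite mul0r; exact: subring0.
  move=> N x sN Nq qx [B [c [[hB AB] [Ac c0 cB] hN]]].
  have [u [v [Au Av v0 E]]] := fracA (x * y).
  have ix : int_over A (x * y).
    by apply/Nu_intq/sub_loc => //; case: (qy x qx).
  have [c' [Ac' c'0 hc']] := int_over_denominator hA Au Av v0 E ix.
  have [B' [c'' [hB' BB' B'x hc'']]] :=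
    adjoin_conductor hA hB AB c0 Ac cB c'0 Ac' hc'.
  exists B', c''; split=> //; first by split=> //; exact: subset_trans BB'.
  move=> _ [n Nn [r Rr <-]]; rewrite mulrDl; apply: subringD => //.
    by apply: BB'; exact: hN.
  by rewrite -mulrA; apply: subringM => //; apply/BB'/AB/RA.
apply: (tors_dvr hA hm _ nA hNuq ANu Nu_intq _ fracA hB AB Ac c0 cB ma a0).
- exact: loc_unit.
- by move=> x; exact: loc_int_closed.
(* If [s * y] is in [Nu], it is in [sigma_set]: each height-one [p] misses some r of [q], and r y is
   already in R_p. Then [s] would lie in [q]. *)
- move=> [s [Rs nqs Nsy]]; apply: nqs; rewrite Eq; split=> //; split=> //.
  move=> p hp; have [pp _ _] := hp; have [sp _ _ pM] := pp.
  have /existsNP[r /not_implyP[qr npr]] := not_sub_ht1 hp.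
  have [u [Ru npu Rury]] := (qy r qr).2 p hp.
  have Rr := qR qr.
  exists (u * r); split; [exact: subringM | by move=> /(pM _ _ Ru Rr)[]|].
  have -> : u * r * (s * y) = s * (u * (r * y)) by ring.
  exact: subringM.
- move=> r [s [Rs nqs qsr]]; have Ssr := qy _ qsr.
  have s0 : s != 0 by apply/eqP => e; apply: nqs; rewrite e; exact: submod0 sq.
  have -> : r * y = s^-1 * (s * r * y) by rewrite -mulrA mulKf.
  have As : A s^-1 by exact: loc_inv.
  split; apply: subringM => //; [exact: AB | exact: By | exact: ANu |].
  by apply: sub_loc => //; case: Ssr.
Qed.

End AtPrime.

Theorem sigma_set_finite_character a : R a -> a != 0 ->
  exists2 X : set (set F), finite_set X &
    (forall V, X V -> dim1 V /\ exists2 P, prime_in sigma_set P & V = loc sigma_set P sigma_set)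
    /\ forall y, sigma_set (a * y) -> (forall V, X V -> V y) -> sigma_set y.
Proof.
move=> Ra a0.
have saR : submod R (scale a R) by apply: submod_scale; exact: subring_submod.
have aRR : scale a R `<=` R by move=> _ [x Rx <-]; exact: subringM.
have naR : noeth R (scale a R) R.
  by apply: noeth_mono nR => // _ ->; exact: submod0 saR.
have aRa : scale a R a by exists 1; rewrite ?mulr1 //; exact: subring1.
(* [X0] collects the R_p for the height-one primes [p] containing [a], and [Y q] the rings above
   another prime [q] containing [a]. *)
pose X0 := [set loc R p R | p in [set p | ht1 R p /\ p a]].
pose Y q := [set V | [/\ prime_in R q, q a, ~ ht1 R q & exists P,
  [/\ prime_in (T q) P, loc R q q `<=` P, dim1 (loc (T q) P (T q)),
      loc R q Nu `<=` loc (T q) P (T q) & V = loc (T q) P (T q)]]].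
have fX0 : finite_set X0.
  apply: finite_image.
  have [X fX hX] := finite_primes_over hR hR (@subset_refl _ R) naR saR aRR.
  apply: sub_finite_set fX => p [hp pa]; have [pp _ minp] := hp.
  have [sp _ _ _] := pp.
  have [|P0 XP0 [pP0 aP0 P0p]] := hX p pp.
    by move=> _ [x Rx <-]; rewrite mulrC; exact: submodM sp _ _.
  suff -> : p = P0 by [].
  apply/seteqP; split=> //; apply: minp => //; exists a => //.
  exact: aP0.
have fY : finite_set (\bigcup_q Y q).
  have [X fX hX] := finite_weak_assoc hR naR saR aRR.
  (* By [dvr_weak_assoc], [Y q] is empty unless [q] is weakly associated to aR. *)
  apply: (sub_finite_set (B := \bigcup_(q in X) Y q)).
    move=> V [q _ YV]; exists q => //.
    have [pq qa nht [P [pP mP d1 _ _]]] := YV.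
    have [x Rx wq] := dvr_weak_assoc pq qa a0 nht pP mP d1.
    exact: hX wq.
  apply: bigcup_finite => // q _.
  have [[pq qa]|nq] := pselect (prime_in R q /\ q a); last first.
    apply: (sub_finite_set (B := set0)) => // V [pq qa _ _].
    by apply: nq.
  apply: sub_finite_set (finite_dvr_at pq qa a0).
  by move=> V [_ _ _ [P [pP mP d1 _ E]]]; exists P.
exists (X0 `|` \bigcup_q Y q); first by rewrite finite_setU.
split.
  move=> V [[p [hp pa] <-]|[q _ [pq qa nht [P [pP mP d1 NV ->]]]]].
    have [pp _ _] := hp.
    have d1 := dim1_loc_ht1 hR nR hp; split=> //.
    apply: dim1_eq_loc => //.
      by move=> x [_]; exact.
    move=> x [s [Rs nps Rsx]]; exists s; split.
    - exact: sub_sigma_set.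
    - by apply/eqP => e; apply: nps; rewrite e; case: pp => /submod0.
    - exact: loc_inv.
    - exact: sub_sigma_set.
  by split=> //; exact: (dvr_sigma_set pq qa a0).
move=> y0 Say XV; apply: contrapT => nSy0.
have sS : submod R sigma_set by apply: subring_submod => //; exact: sub_sigma_set.
pose C s := [set r | R r /\ sigma_set (r * (s * y0))].
have [||q [s [Rs nSy Eq]] maxq] := nR
    (Phi := [set q | exists s, [/\ R s, ~ sigma_set (s * y0) & q = C s]]).
- by exists (C 1), 1; rewrite mul1r; split=> //; exact: subring1.
- move=> _ [s [Rs nSy ->]]; split; first exact: submod_colon.
  + move=> _ ->; split; first exact: subring0.
    by rewrite mul0r; exact: subring0.
  + by move=> r [].
pose y := s * y0.
have XVy V : (X0 `|` \bigcup_q Y q) V -> subring V -> R `<=` V -> V y.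
  by move=> XV' hV RV; apply: subringM => //; [exact: RV | exact: XV].
have pq : prime_in R q.
  rewrite Eq; split.
  - exact: submod_colon.
  - by move=> r [].
  - by rewrite /C /= mul1r => -[].
  - move=> u v Ru Rv [_ Suv]; have [Su|nSu] := pselect (sigma_set (u * y)).
      by left.
    right; have : C (u * s) `<=` q.
      apply: maxq; first by exists (u * s); rewrite -mulrA; split=> //; exact: subringM.
      move=> r; rewrite Eq => -[Rr Sr]; split=> //.
      rewrite -mulrA mulrCA; apply: subringM => //; exact: sub_sigma_set.
    rewrite Eq; apply; split=> //.
    have -> : v * (u * s * y0) = u * v * (s * y0) by ring.
    by [].
have qa : q a.
  rewrite Eq; split=> //; rewrite mulrCA; apply: subringM => //; exact: sub_sigma_set.
have [hq|nht] := pselect (ht1 R q).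
  have [t [Rt nqt Rty]] : loc R q R y.
    apply: XVy; first by left; exists q.
      exact: loc_subring.
    exact: sub_loc.
  by apply: nqt; rewrite Eq; split=> //; exact: sub_sigma_set.
have [P [pP mP d1 NV nVy]] := separate_at pq qa a0 nht Eq nSy.
apply: nVy; apply: XVy; first by right; exists q => //; split=> //; exists P.
  by case: d1.
by move=> x Rx; apply: NV; apply: sub_loc => //; exact: RNu.
Qed.

End SigmaSet.

(** * Transfer between a ring and its image in a field *)

Section Transfer.
Variables (U : comNzRingType) (F : fieldType) (f : {rmorphism U -> F}).
Hypothesis injf : injective f.

Lemma range_subring : subring (range f).
Proof.
split; first by exists 1; rewrite ?rmorph1.
- by move=> _ _ [u _ <-] [v _ <-]; exists (u - v); rewrite ?rmorphB.
- by move=> _ _ [u _ <-] [v _ <-]; exists (u * v); rewrite ?rmorphM.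
Qed.

Lemma image_mem (P : set U) u : (f @` P) (f u) -> P u.
Proof. by move=> [v Pv /injf <-]. Qed.

Lemma prime_image (P : set U) : prime_ideal P <-> prime_in (range f) (f @` P).
Proof.
split.
  move=> [[/set_mem P0 /negP P1 PD] pP].
  have PD' a u v : P u -> P v -> P (a * u + v).
    by move=> Pu Pv; apply: set_mem; apply: PD; exact: mem_set.
  split; first split.
  - by exists 0 => //; rewrite rmorph0.
  - move=> _ _ [u Pu <-] [v Pv <-]; exists (- 1 * v + u); first exact: PD'.
    by rewrite mulN1r addrC rmorphB.
  - move=> _ _ [r _ <-] [u Pu <-]; exists (r * u + 0); first exact: PD'.
    by rewrite addr0 rmorphM.
  - by move=> _ [u _ <-]; exists u.
  - by move=> [u Pu]; rewrite -(rmorph1 f) => /injf u1; apply: P1; rewrite inE -u1.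
  - move=> _ _ [u _ <-] [v _ <-]; rewrite -rmorphM => /image_mem/mem_set/pP.
    by move=> /orP[/set_mem Pu|/set_mem Pv]; [left; exists u | right; exists v].
move=> [sP PR P1 pP].
have fP u : P u -> (f @` P) (f u) by move=> Pu; exists u.
split; first split.
- apply: mem_set; apply: image_mem.
  by rewrite rmorph0; exact: submod0 sP.
- by apply/negP => /set_mem/fP; rewrite rmorph1.
- move=> a u v /set_mem Pu /set_mem Pv; apply: mem_set; apply: image_mem.
  rewrite rmorphD rmorphM; apply: (submodD sP); last exact: fP.
  by apply: (submodM sP); [exists a | exact: fP].
- move=> u v /set_mem/fP; rewrite rmorphM.
  move=> /(pP _ _ (ex_intro2 _ _ u I erefl) (ex_intro2 _ _ v I erefl))[] /image_mem /mem_set h.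
    by apply/orP; left.
  by apply/orP; right.
Qed.

Lemma preimage_rangeK (Q : set F) : Q `<=` range f -> f @` (f @^-1` Q) = Q.
Proof.
move=> QR; apply/seteqP; split=> [_ [u Qu <-] //|x Qx].
by have [u _ E] := QR _ Qx; exists u => //; rewrite /preimage /= E.
Qed.

(* {0} is prime because U embeds into a field. *)
Lemma prime_ideal0 : prime_ideal [set 0 : U].
Proof.
apply/prime_image; have -> : f @` [set 0] = [set 0].
  apply/seteqP; split=> x; first by move=> [_ -> <-]; rewrite rmorph0.
  by move=> ->; exists 0; rewrite ?rmorph0.
split; first split=> //.
- by move=> _ _ -> ->; rewrite subrr.
- by move=> r _ _ ->; rewrite mulr0.
- by move=> _ ->; exact: subring0 range_subring.
- by apply/eqP; exact: oner_neq0.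
- move=> x y _ _ /eqP; rewrite mulf_eq0 => /orP[/eqP|/eqP]; first by left.
  by right.
Qed.

Lemma height_ge1 (P : set U) u : prime_ideal P -> P u -> u != 0 ->
  prime_height_ge P 1.
Proof.
move=> pP Pu u0; exists (fun i => if i == 0%N then [set 0] else P); split=> //.
- by case=> [|i] _ //; exact: prime_ideal0.
- case=> // _; split=> [_ ->|/(_ _ Pu) /eqP]; last by rewrite (negPf u0).
  by case: pP => [[/set_mem]].
Qed.

(** Since {0} is prime, a nonzero prime strictly inside [P] gives a chain of length 2, and
    conversely the middle term of such a chain is a nonzero prime strictly inside [P]. *)
Lemma height1P (P : set U) : (prime_ideal P /\ prime_height P 1) <->
  ht1 (range f) (f @` P).
Proof.
split.
  move=> [pP [[c [cp cs cP]] nh]].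
  have [c01 nc10] := cs 0%N isT; rewrite cP in c01 nc10.
  split; first exact/prime_image.
    move/existsNP: nc10 => [u /not_implyP[Pu nu]].
    exists (f u); first by exists u.
    rewrite -(rmorph0 f) (inj_eq injf); apply/eqP => u0; apply: nu; rewrite u0.
    by case: (cp 0%N isT) => [[/set_mem]].
  move=> Q pQ QP [x Qx x0] _ [v Pv <-].
  apply: contrapT => nQv; apply: nh.
  have QR : Q `<=` range f by case: pQ.
  pose P' := f @^-1` Q.
  have pP' : prime_ideal P' by apply/prime_image; rewrite preimage_rangeK.
  exists (fun i => if i == 0%N then [set 0] else if i == 1%N then P' else P).
  split=> //; first by case=> [|[|i]] _ //; exact: prime_ideal0.
  case=> [|[|//]] _; split.
  - by move=> _ ->; case: pP' => [[/set_mem]].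
  - have [u _ E] := QR _ Qx; move=> /(_ u); rewrite /P' /= E => /(_ Qx) u0.
    by move: x0; rewrite -E u0 rmorph0 eqxx.
  - by move=> u /QP /image_mem.
  - by move=> /(_ _ Pv).
move=> [/prime_image pP [_ [u Pu <-] u0] minP]; split=> //.
have {}u0 : u != 0 by apply: contra_neq u0 => ->; rewrite rmorph0.
split; first exact: height_ge1 Pu u0.
move=> [c [cp cs cP]].
have [_ /existsNP[w /not_implyP[c1w nc0w]]] := cs 0%N isT.
have [c12 nc21] := cs 1%N isT; rewrite cP in c12 nc21; apply: nc21.
have w0 : w != 0.
  by apply/eqP => w0; apply: nc0w; rewrite w0; case: (cp 0%N isT) => [[/set_mem]].
move=> v Pv; apply: image_mem; apply: (minP (f @` c 1%N)); last by exists v.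
- by apply/prime_image; exact: cp.
- by move=> _ [t c1t <-]; exists t => //; exact: c12.
- by exists (f w); [exists w | rewrite -(rmorph0 f) (inj_eq injf)].
Qed.

(** Without a maximal element, choice yields a strictly increasing sequence; its union is finitely
    generated, so it stops at an index [K] by which all generators have appeared. *)
Lemma noetherian_noeth : noetherian U -> noeth (range f) [set 0] (range f).
Proof.
move=> nU Phi [N0 PN0] h; apply: contrapT => nmax.
have /choice[nxt hnxt] : forall N, exists N', Phi N ->
    [/\ Phi N', N `<=` N' & ~ N' `<=` N].
  move=> N; have [PN|] := pselect (Phi N); last by exists N.
  apply: contrapT => nN; apply: nmax; exists N => // N' PN' NN'.
  by apply: contrapT => nN'N; apply: nN; exists N'.
pose c n := iter n nxt N0.
have Pc n : Phi (c n) by elim: n => //= n /hnxt[].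
have inc i j : (i <= j)%N -> c i `<=` c j.
  move=> /subnK <-; elim: (j - i)%N => [|k IH] //=.
  by apply: subset_trans IH _; have [_] := hnxt _ (Pc (k + i)%N).
pose J : set U := [set u | exists n, c n (f u)].
have [n [g EJ]] : exists (n : nat) (g : 'I_n -> U),
    J = [set x | exists b : 'I_n -> U, x = \sum_i b i * g i].
  apply: nU; split.
    by apply: mem_set; exists 0%N; rewrite rmorph0; have [sN _ _] := h _ PN0; exact: submod0 sN.
  move=> a u v /set_mem[i ci] /set_mem[j cj]; apply: mem_set; exists (maxn i j).
  have [sN _ _] := h _ (Pc (maxn i j)).
  rewrite rmorphD rmorphM; apply: (submodD sN).
    by apply: (submodM sN); [exists a | exact: inc (leq_maxl _ _) _ ci].
  exact: inc (leq_maxr _ _) _ cj.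
have Jg i : J (g i).
  rewrite EJ; exists (fun j => (j == i)%:R); rewrite (bigD1 i) //= eqxx mul1r.
  by rewrite big1 ?addr0 // => j /negPf ->; rewrite mul0r.
have /choice[k hk] := Jg.
pose K := \max_i k i.
have [_ _] := hnxt _ (Pc K); apply=> x cx.
have [_ _ /(_ _ cx)[u _ Eu]] := h _ (Pc K.+1).
have : J u by exists K.+1; rewrite Eu.
rewrite EJ => -[b Eb]; rewrite -Eu Eb rmorph_sum.
have [sN _ _] := h _ (Pc K).
apply: big_ind.
- exact: submod0 sN.
- by move=> y z cy cz; exact: submodD sN _ _.
- move=> i _; rewrite rmorphM; apply: (submodM sN); first by exists (b i).
  by apply: inc (hk i); exact: leq_bigmax.
Qed.

End Transfer.

(** * The fraction field and the normalization *)

Section Frac.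
Variable R : idomainType.
Local Notation K := {fraction R}.
Local Notation "x %:F" := (@tofrac R x).
Local Notation R0 := (range (@tofrac R)).

Lemma fraction_div (x : K) : exists a b, b != 0 /\ x = a%:F / b%:F.
Proof.
have [a [b [b0 E]]] : exists a b, b != 0 /\ x * b%:F = a%:F.
  elim/quotW: x => x; exists (\n_x), (\d_x); split; first exact: denom_ratioP.
  rewrite !piE; apply/eqmodP; rewrite /= FracField.equivfE /FracField.mulf.
  rewrite !numden_Ratio ?mulr1 ?mulf_neq0 ?oner_eq0 ?denom_ratioP //.
  by rewrite mulrC.
exists a, b; split=> //.
by rewrite -E mulfK // tofrac_eq0.
Qed.

Lemma tofrac_inj : injective (@tofrac R).
Proof. by move=> x y /eqP; rewrite tofrac_eq => /eqP. Qed.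

Lemma normalization_int_over (x : K) : normalization x -> int_over R0 x.
Proof.
move=> [p mp /rootP]; set q := map_poly _ p => E.
have mq : q \is monic by exact: monic_map.
have sq : (size q).-1.+1 = size q.
  by rewrite prednK // size_poly_gt0 monic_neq0.
exists (size q).-1, (fun i => - q`_i); split.
  by move=> i; exists (- p`_i) => //; rewrite tofracN /q coef_map.
have Ex : \sum_(i < (size q).-1) q`_i * x ^+ i + x ^+ (size q).-1 = 0.
  rewrite -[RHS]E horner_coef -[in RHS]sq big_ord_recr /=.
  by have /monicP := mq; rewrite /lead_coef => ->; rewrite mul1r.
rewrite -[RHS]addr0 -[X in _ = _ + X]Ex addrA -big_split big1 ?add0r // => i _.
by rewrite /= mulNr addNr.
Qed.

Lemma int_over_normalization (x : K) :
  int_over (@normalization R) x -> normalization x.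
Proof.
move=> [n [w [Nw E]]]; pose q := \poly_(i < n) w i.
have sq : (size (- q) < size ('X^n : {poly K})%R)%N.
  by rewrite size_polyXn size_polyN ltnS; exact: size_poly.
(* Transitivity of integrality: [x] is a root of a monic polynomial with coefficients in the
   normalization. *)
apply: (@integral_root_monic _ _ _ x ('X^n - q)).
- by rewrite monicE lead_coefDl // lead_coefXn.
- apply/rootP; rewrite hornerD hornerN hornerXn E horner_poly subrr.
  by [].
- apply/integral_poly => i; rewrite coefB coefXn coef_poly.
  apply: integral_sub; first exact: integral_nat.
  by case: ifP => _; [exact: Nw | exact: integral0].
Qed.

Lemma sigmaE : @sigma R = sigma_set R0 (@normalization R).
Proof.
apply/seteqP; split=> x.
  move=> [nx Nx]; split=> // p hp; have [[_ pR _ _] _ _] := hp.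
  have [pp h1] : prime_ideal (@tofrac R @^-1` p) /\ prime_height (@tofrac R @^-1` p) 1.
    by apply/(height1P tofrac_inj); rewrite preimage_rangeK.
  have [r [s [ns ->]]] := nx _ (conj pp h1); exists s%:F; split=> //.
  by exists r => //; rewrite mulrC divfK //; exact: prime_neq0 pp ns.
move=> [Nx hx]; split=> // p hp.
have [s [[s' _ <-] ns [r _ E]]] := hx _ ((height1P tofrac_inj p).1 hp).
have ns' : ~ p s' by move=> ps'; apply: ns; exists s'.
exists r, s'; split=> //; have [pp _] := hp.
by rewrite E mulrC mulKf //; exact: prime_neq0 pp ns'.
Qed.

End Frac.

(** * Primary ideals contracted from one-dimensional local rings *)

Section OneDimensional.
Variables (U : comNzRingType) (F : fieldType) (f : {rmorphism U -> F}).
Hypothesis injf : injective f.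
Local Notation S := (range f).

Variables (a : U) (V : set F).
Hypotheses (a0 : a != 0) (d1 : dim1 V) (nVa : ~ V (f a)^-1).
Hypothesis VP : exists2 P, prime_in S P & V = loc S P S.

(** The contraction to [U] of the principal ideal aV. *)
Let Q : set U := [set u | V (f u / f a)].
Let hV : subring V. Proof. by case: d1. Qed.
Let fa0 : f a != 0. Proof. by rewrite -(rmorph0 f) (inj_eq injf). Qed.
Let SV u : V (f u).
Proof.
have [P pP ->] := VP; apply: sub_loc => //.
exact: range_subring.
Qed.
Let Qa : Q a. Proof. by rewrite /Q /= divff //; exact: subring1. Qed.

(** A unit [v] of [V] cancels from a product in aV; for a nonunit, [dim1] puts a power of [v] into
    aV. *)
Lemma primary_dim1 : primary_ideal Q.
Proof.
split; first split.
- by apply: mem_set; rewrite /Q /= rmorph0 mul0r; exact: subring0.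
- by apply/negP => /set_mem; rewrite /Q /= rmorph1 mul1r.
- move=> b u v /set_mem Qu /set_mem Qv; apply: mem_set.
  rewrite /Q /= rmorphD rmorphM mulrDl -mulrA.
  by apply: subringD => //; exact: subringM.
(* The case of 0 is set aside because 0^-1 = 0 lies in [V]. *)
move=> u v Quv; have [v0|v0] := eqVneq (f v) 0.
  by right; exists 1; rewrite /Q /= expr1 v0 mul0r; exact: subring0.
have [Vv|nVv] := pselect (V (f v)^-1).
  left; rewrite /Q /=; have -> : f u / f a = f (u * v) / f a * (f v)^-1.
    by rewrite rmorphM; field; rewrite fa0 v0.
  exact: subringM.
right; have [n Vn] := (d1.2 _ _ (SV v) (SV a) nVv).
by exists n; rewrite /Q /= rmorphXn.
Qed.

(** Primes over [Q] contain the nonzero [a]. The prime [P] with V = S_P contains [Q], because [a] is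
    a nonunit of [V], and has height one by [dim1_loc_minimal]. *)
Lemma height_dim1 : ideal_height Q 1.
Proof.
split; first by move=> P pP QP; apply: (height_ge1 injf pP (QP _ Qa) a0).
have [P pP EV] := VP; have [sP PS P1 _] := pP.
have QP u : Q u -> P (f u).
  move=> Qu; apply: contrapT => nPu; apply: nVa.
  have u0 : f u != 0 by apply/eqP => e; apply: nPu; rewrite e; exact: submod0 sP.
  have -> : (f a)^-1 = f u / f a * (f u)^-1 by field; rewrite fa0 u0.
  apply: subringM => //; rewrite EV; exists (f u); split=> //.
  by rewrite divff //; exists 1; rewrite ?rmorph1.
have [pP' h] : prime_ideal (f @^-1` P) /\ prime_height (f @^-1` P) 1.
  apply/(height1P injf); rewrite preimage_rangeK //; split=> //.
    by exists (f a) => //; exact: QP.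
  move=> P0 pP0 P0P [x P0x x0].
  apply: (dim1_loc_minimal _ pP _ pP0 P0P P0x x0); first exact: range_subring.
  by rewrite -EV.
by exists (f @^-1` P).
Qed.

End OneDimensional.

(** * Primary decomposition of the principal ideals of R^sigma *)

Theorem theorem6p6 (R : idomainType) (hR : noetherian R) : S2 (sigma_ring R).
Proof.
move=> a a0.
pose f : {rmorphism sigma_ring R -> {fraction R}} := val.
have injf : injective f by exact: val_inj.
have ES : range f = @sigma R.
  apply/seteqP; split=> [_ [u _ <-]|x Sx]; first exact: set_mem (valP u).
  by exists (SigmaRing (mem_set Sx)).
pose R0 := range (@tofrac R); pose Nu := @normalization R.
have hR0 : subring R0 := range_subring (@tofrac R).
have nR0 : noeth R0 [set 0] R0 := noetherian_noeth hR.
have hNu : subring Nu.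
  split; first by rewrite -tofrac1; exact: integral_id.
  - by move=> x y; exact: integral_sub.
  - by move=> x y; exact: integral_mul.
have RNu : R0 `<=` Nu by move=> _ [r _ <-]; exact: integral_id.
have fracR x : exists u v, [/\ R0 u, R0 v, v != 0 & x = u / v].
  have [u [v [v0 ->]]] := fraction_div x.
  by exists (tofrac u), (tofrac v); rewrite tofrac_eq0; split=> //; [exists u | exists v].
have fa0 : f a != 0 by rewrite -(rmorph0 f) (inj_eq injf).
have SR0 : R0 `<=` @sigma R by move=> _ [r _ <-]; exact: tofrac_sigma.
have hS : subring (@sigma R) by rewrite -ES; exact: range_subring.
have Sf u : @sigma R (f u) by rewrite -ES; exists u.
(* A multiple of [a] by an element of R^sigma is a nonzero element of [R]; the finite set [X] is
   taken for that multiple. *)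
have [a' [Rr r0 /(_ _ hS SR0 (Sf a)) Sa']] :=
  int_over_multiple hR0 (normalization_int_over (Sf a).2) fa0.
have [X fX [hX XS]] := sigma_set_finite_character hR0 nR0 hNu RNu
  (@normalization_int_over R) (@int_over_normalization R) fracR Rr r0.
rewrite -sigmaE -ES in hX XS.
(* The [V] in which [a] is a unit are dropped: aV contracts to the whole ring there, which is not a
   primary ideal. *)
have /finite_seqP[s Es] : finite_set (X `&` [set V | ~ V (f a)^-1]).
  by apply: sub_finite_set fX => V [].
have hs i : (X `&` [set V | ~ V (f a)^-1]) (tnth (in_tuple s) i).
  by rewrite Es /=; exact: mem_tnth.
exists (size s), (fun i => [set u | tnth (in_tuple s) i (f u / f a)]); split.
  move=> i; have [XV nV] := hs i; have [d1 VP] := hX _ XV.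
  by split; [exact: primary_dim1 | exact: height_dim1].
apply/seteqP; split=> u.
  move=> [b _ <-] i _; have [XV _] := hs i; have [d1 [P pP EV]] := hX _ XV.
  rewrite /mkset rmorphM mulrC mulKf // EV; apply: sub_loc => //.
  exact: range_subring.
(* The quotient u/a lies in every [V] of [X], and (a a')(u/a) = a' u lies in R^sigma; so u/a lies in
   R^sigma. *)
move=> hu; have [b _ Eb] : range f (f u / f a).
  apply: XS.
    rewrite ES; have -> : f a * a' * (f u / f a) = a' * f u by field.
    exact: subringM.
  move=> V XV; have [d1 [P pP EV]] := hX _ XV.
  have [Va|nVa] := pselect (V (f a)^-1).
    apply: subringM => //; first by case: d1.
    rewrite EV; apply: sub_loc => //.
    exact: range_subring.
  have sV : [set` s] V by rewrite -Es.
  have /tnthP[i ->] : V \in in_tuple s by exact: sV.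
  exact: hu.
by exists b => //; apply: injf; rewrite rmorphM Eb mulrC divfK.
Qed.
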